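(* There is a universal constant $c_0>0$ such that the following holds. Let $\ell\ge2$, let $\kappa\in\mathbb{N}_+^\ell$ with $\kappa_1+\cdots+\kappa_\ell=n$, and let $A\subseteq\mathcal{U}_\kappa$. Let $p,\epsilon>0$, and assume $\kappa_i\ge pn$ for all $i\in[\ell]$ and $\epsilon\le\mathrm{vol}(A)\le1-\epsilon$. Then for any $\delta>0$, either $$\mathbf{E}_{\kappa'\sim\mathbf{lower}(\kappa)}\bigl[\mathrm{vol}(\partial_{\kappa'}A)\bigr]\ \ge\ \mathrm{vol}(A)+\frac{\log n}{n}\cdot c_0\cdot\frac{\epsilon\delta}{\ell\log(1/p)},$$ or else there exists $\tau\in\mathrm{Trans}(n)$ with $\mathrm{Inf}_\tau[A]\ge1/n^\delta$. The analogous statement for upper shadows (with $\mathbf{upper}(\kappa)$ in place of $\mathbf{lower}(\kappa)$) also holds.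
   Context: For $\mu\in\mathbb{N}^\ell$ with $\sum_i\mu_i=n$, $\mathcal{U}_\mu=\{u\in[\ell]^n : u \text{ has exactly } \mu_i \text{ coordinates equal to } i,\ \forall i\in[\ell]\}$; for $B\subseteq\mathcal{U}_\mu$, $\mathrm{vol}(B)=|B|/|\mathcal{U}_\mu|$ (volume is relative to the containing multislice). $S_n$ acts by $(u^\sigma)_j=u_{\sigma(j)}$; $\mathrm{Trans}(n)$ is the set of all transpositions in $S_n$; $\mathrm{Inf}_\tau[A]=\Pr_{u}[u\in A,\ u^\tau\notin A]$ with $u$ uniform on $\mathcal{U}_\kappa$. Order colors $1\prec2\prec\cdots\prec\ell$, and extend to the coordinatewise partial order on $[\ell]^n$ ($u\prec v$ iff $u\ne v$ and $u_j\preceq v_j$ for all $j$). A histogram $\kappa'$ is a lower neighbor of $\kappa$ if for some colors $c\prec d$: $\kappa'_c=\kappa_c+1$, $\kappa'_d=\kappa_d-1$, and $\kappa'_i=\kappa_i$ for other $i$; it is an upper neighbor if the same holds with $c\succ d$. For $\kappa'$ a lower neighbor, the lower shadow of $A$ at $\kappa'$ is $\partial_{\kappa'}A=\{u\in\mathcal{U}_{\kappa'} : u\prec v\text{ for some }v\in A\}$; for $\kappa'$ an upper neighbor, the upper shadow is $\partial_{\kappa'}A=\{u\in\mathcal{U}_{\kappa'} : v\prec u\text{ for some }v\in A\}$. The distribution $\mathbf{lower}(\kappa)$ on lower neighbors: take any $u\in\mathcal{U}_\kappa$; choose $j,j'\in[n]$ independently and uniformly, conditioned on $u_j\ne u_{j'}$;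 let $c\prec d$ be the two colors $u_j,u_{j'}$; output $\kappa'$ with $\kappa'_c=\kappa_c+1$, $\kappa'_d=\kappa_d-1$, other entries unchanged (the distribution does not depend on $u$). The distribution $\mathbf{upper}(\kappa)$ is the same except that the output has $\kappa'_d=\kappa_d+1$, $\kappa'_c=\kappa_c-1$. *)

(* Defs.v *)
From HB Require Import structures.
From mathcomp Require Import all_boot all_order all_fingroup all_algebra.
From mathcomp Require Import reals exp.

Set Implicit Arguments.
Unset Strict Implicit.
Unset Printing Implicit Defensive.

Import Order.TTheory GRing.Theory Num.Theory.

Local Open Scope ring_scope.

(* The colors 1 < ... < l are the ordinals 0 < ... < l-1. *)
Definition histogram (l : nat) := {ffun 'I_l -> nat}.
Definition coloring (l n : nat) := {ffun 'I_n -> 'I_l}.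

Definition multislice (l n : nat) (kappa : histogram l) : {set coloring l n} :=
  [set u : coloring l n | [forall i : 'I_l, #|[set j | u j == i]| == kappa i]].

Definition vol (R : realType) (l n : nat) (kappa : histogram l)
    (B : {set coloring l n}) : R :=
  #|B|%:R / #|multislice n kappa|%:R.

Definition act (l n : nat) (u : coloring l n) (s : 'S_n) : coloring l n :=
  [ffun j => u (s j)].

Definition Trans (n : nat) : {set 'S_n} :=
  [set tperm ij.1 ij.2 | ij : 'I_n * 'I_n & ij.1 != ij.2].

Definition Inf (R : realType) (l n : nat) (kappa : histogram l)
    (A : {set coloring l n}) (tau : 'S_n) : R :=
  #|[set u in multislice n kappa | (u \in A) && (act u tau \notin A)]|%:R
    / #|multislice n kappa|%:R.

Definition prec (l n : nat) (u v : coloring l n) : bool :=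
  (u != v) && [forall j, (u j <= v j)%N].

Definition lower_shadow (l n : nat) (kappa' : histogram l)
    (A : {set coloring l n}) : {set coloring l n} :=
  [set u in multislice n kappa' | [exists v in A, prec u v]].

Definition upper_shadow (l n : nat) (kappa' : histogram l)
    (A : {set coloring l n}) : {set coloring l n} :=
  [set u in multislice n kappa' | [exists v in A, prec v u]].

(* One coordinate is recolored from [a] to [b]; used only when a != b and
   0 < kappa a, so that the truncated predecessor is harmless. *)
Definition recolor (l : nat) (kappa : histogram l) (a b : 'I_l) : histogram l :=
  [ffun i => if i == b then (kappa i).+1
             else if i == a then (kappa i).-1 else kappa i].

Definition bichromatic (l n : nat) (u : coloring l n) : {set 'I_n * 'I_n} :=
  [set jj | u jj.1 != u jj.2].

(* Expectation of g c d, where c < d are the two colors u_j and u_j' for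
   (j, j') uniform among the pairs with u_j <> u_j'. *)
Definition expect_colors (R : realType) (l n : nat) (u : coloring l n)
    (g : 'I_l -> 'I_l -> R) : R :=
  (\sum_(jj in bichromatic u)
      if (u jj.1 < u jj.2)%N then g (u jj.1) (u jj.2)
      else g (u jj.2) (u jj.1))
    / #|bichromatic u|%:R.

(* Expectations of f kappa' for kappa' drawn from lower(kappa) and upper(kappa),
   computed from some u in the multislice; by [expect_lowerE] and
   [expect_upperE] the choice of u is irrelevant. *)
Definition expect_lower (R : realType) (l n : nat) (kappa : histogram l)
    (f : histogram l -> R) : R :=
  if [pick u in multislice n kappa] is Some u
  then expect_colors u (fun c d => f (recolor kappa d c)) else 0.

Definition expect_upper (R : realType) (l n : nat) (kappa : histogram l)
    (f : histogram l -> R) : R :=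
  if [pick u in multislice n kappa] is Some u
  then expect_colors u (fun c d => f (recolor kappa c d)) else 0.

Lemma sum_coloring (V : nmodType) (l n : nat) (kappa : histogram l)
    (u : coloring l n) (h : 'I_l -> V) :
  u \in multislice n kappa ->
  \sum_(j < n) h (u j) = \sum_(a < l) h a *+ kappa a.
Proof.
rewrite inE => /forallP uk.
rewrite (partition_big u predT) //=; apply: eq_bigr => a _.
rewrite -(eqP (uk a)) -sumr_const; apply: eq_big => [j|j /eqP -> //].
by rewrite inE.
Qed.

Lemma sum_bichromatic (V : nmodType) (l n : nat) (kappa : histogram l)
    (u : coloring l n) (h : 'I_l -> 'I_l -> V) :
  u \in multislice n kappa ->
  \sum_(jj in bichromatic u) h (u jj.1) (u jj.2) =
  \sum_(a < l) (\sum_(b < l) (if a != b then h a b else 0) *+ kappa b)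
    *+ kappa a.
Proof.
move=> uk.
rewrite -(sum_coloring
  (fun a => \sum_(b < l) (if a != b then h a b else 0) *+ kappa b) uk).
under [RHS]eq_bigr => j _ do
  rewrite -(sum_coloring (fun b => if u j != b then h (u j) b else 0) uk).
rewrite pair_big /= [LHS]big_mkcond /=.
by apply: eq_bigr => jj _; rewrite inE.
Qed.

Lemma expect_colors_indep (R : realType) (l n : nat) (kappa : histogram l)
    (u v : coloring l n) (g : 'I_l -> 'I_l -> R) :
  u \in multislice n kappa -> v \in multislice n kappa ->
  expect_colors u g = expect_colors v g.
Proof.
move=> uk vk; rewrite /expect_colors -!sum1_card !natr_sum.
pose h (a b : 'I_l) := if (a < b)%N then g a b else g b a.
rewrite (sum_bichromatic h uk) (sum_bichromatic h vk).
by rewrite (sum_bichromatic (fun _ _ => 1) uk) (sum_bichromatic (fun _ _ => 1) vk).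
Qed.

Lemma expect_lowerE (R : realType) (l n : nat) (kappa : histogram l)
    (f : histogram l -> R) (u : coloring l n) :
  u \in multislice n kappa ->
  expect_lower n kappa f = expect_colors u (fun c d => f (recolor kappa d c)).
Proof.
move=> uk; rewrite /expect_lower; case: pickP => [v vk|/(_ u)]; last by rewrite uk.
exact: expect_colors_indep vk uk.
Qed.

Lemma expect_upperE (R : realType) (l n : nat) (kappa : histogram l)
    (f : histogram l -> R) (u : coloring l n) :
  u \in multislice n kappa ->
  expect_upper n kappa f = expect_colors u (fun c d => f (recolor kappa c d)).
Proof.
move=> uk; rewrite /expect_upper; case: pickP => [v vk|/(_ u)]; last by rewrite uk.
exact: expect_colors_indep vk uk.
Qed.

(* Main.v *)
Require Import Defs.
From mathcomp Require Import all_boot all_order all_fingroup all_algebra.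
From mathcomp Require Import reals exp ring lra zify.

Import Order.TTheory GRing.Theory Num.Theory.
Local Open Scope ring_scope.

Set Implicit Arguments.
Unset Strict Implicit.
Unset Printing Implicit Defensive.

(* Let J be the number of pairs (u, tau), tau a transposition, with u in A and
   u^tau outside A.  A point w of the shadow has, among its neighbours, a
   fraction t > 0 in A, and 1 >= t + t(1 - t); summing t gives vol(A), and
   summing t(1 - t) counts pairs of neighbours of w separated by A, which differ
   by a transposition.  Hence the shadow gains a multiple of J, and it remains to
   bound J from below when all influences are small.

   This follows from a log-Sobolev inequality for random transpositions on the
   multislice, as in Falik and Samorodnitsky.  Write the indicator f of A as the
   sum of the martingale differences d_i obtained by revealing the coordinates
   in a uniformly random order.  The transpositions form a conjugacy class, so the
   Dirichlet form is additive along this decomposition, and the log-Sobolev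
   inequality applied to each d_i bounds J below by the sum of the
   Ent(d_i^2) >= |d_i|_2^2 ln(|d_i|_2^2 / |d_i|_1^2), where |d_i|_1 is at most an
   average of influences.

   The log-Sobolev inequality is proved by induction on n, conditioning on one
   coordinate: the entropy of the conditional means is controlled by the complete
   graph on the colors, and swapping two coordinates couples any two
   conditionings.  Averaging over the conditioned coordinate, with the swapped
   pair held fixed, makes the proportions of the colors essentially constant. *)

(* [all_fingroup] exports another [act]. *)
Local Notation act := Defs.act.

(** * Entropy and the complete graph *)

Section Logarithm.
Variable R : realType.
Implicit Types x y t m K : R.

Lemma ln_le_sub1 x : 0 < x -> ln x <= x - 1.
Proof.
move=> x0; have {1}-> : x = 1 + (x - 1) by ring.
by apply: le_ln1Dx; lra.
Qed.

(** The left side is the tangent line at [t] of the convex function [x ln x]. *)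
Lemma ln_tangent x t : 0 <= x -> 0 < t -> x * ln t + x - t <= x * ln x.
Proof.
move=> x0 t0; have [->|xn0] := eqVneq x 0; first by lra.
have xp : 0 < x by rewrite lt_def xn0.
have h : ln t - ln x <= t / x - 1.
  by rewrite -ln_div ?posrE //; apply: ln_le_sub1; rewrite divr_gt0.
have : x * (ln t - ln x) <= x * (t / x - 1) by rewrite ler_pM2l.
rewrite [X in _ <= X](_ : _ = t - x); last by field.
by lra.
Qed.

(** The left side is the Bregman divergence of [y ln y] between [x ^+ 2] and [m ^+ 2]. It vanishes
    to second order at [x = m], and a large ratio [x / m] costs only its logarithm. *)
Lemma sqr_ln_le x m K : 0 <= x -> 0 < m -> 1 <= K -> x <= m * K ->
  x ^+ 2 * ln (x ^+ 2) - x ^+ 2 * ln (m ^+ 2) - x ^+ 2 + m ^+ 2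
    <= (3 + 2 * ln K) * (x - m) ^+ 2.
Proof.
move=> x0 m0 K1 xK.
have lK : 0 <= ln K by rewrite ln_ge0.
have [->|xn0] := eqVneq x 0.
  have : 0 <= ln K * m ^+ 2 by rewrite mulr_ge0 ?sqr_ge0.
  by have := sqr_ge0 m; lra.
have xp : 0 < x by rewrite lt_def xn0.
rewrite !lnXn // !mulr2n.
pose r := ln x - ln m.
have rK : r <= ln K.
  rewrite /r -ln_div ?posrE // ler_ln ?posrE ?divr_gt0 //; last lra.
  by rewrite ler_pdivrMr // mulrC.
have rx : m * r <= x - m.
  have : r <= x / m - 1 by rewrite /r -ln_div ?posrE //; apply: ln_le_sub1; rewrite divr_gt0.
  rewrite -(ler_pM2l m0); congr (_ <= _); by field; lra.
rewrite [X in X <= _](_ : _ = 2 * x ^+ 2 * r - (x ^+ 2 - m ^+ 2)); last by rewrite /r; ring.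
(* For [x >= m], write [x ^+ 2 = (x - m) ^+ 2 + m (2 x - m)] and use [r <= ln K] on the first
   summand, [m r <= x - m] on the second. For [x < m] the latter bound suffices. *)
have [mx|xm] := leP m x.
  have h1 : (x - m) ^+ 2 * r <= (x - m) ^+ 2 * ln K by rewrite ler_wpM2l ?sqr_ge0.
  have h2 : (2 * x - m) * (m * r) <= (2 * x - m) * (x - m) by rewrite ler_wpM2l //; lra.
  have -> : 2 * x ^+ 2 * r = 2 * ((x - m) ^+ 2 * r) + 2 * ((2 * x - m) * (m * r)) by ring.
  have -> : x ^+ 2 - m ^+ 2 = 2 * ((2 * x - m) * (x - m)) - 3 * (x - m) ^+ 2 by ring.
  by lra.
have h3 : 0 <= (x - m) ^+ 2 * ln K by rewrite mulr_ge0 ?sqr_ge0.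
rewrite -(ler_pM2l m0).
have h1 : x ^+ 2 * (m * r) <= x ^+ 2 * (x - m) by rewrite ler_wpM2l ?sqr_ge0.
have h2 : 0 <= (x - m) ^+ 2 * (2 * (m - x)) by rewrite mulr_ge0 ?sqr_ge0 //; lra.
have h4 : 0 <= m * ((x - m) ^+ 2 * ln K) by rewrite mulr_ge0 // ltW.
have -> : m * (2 * x ^+ 2 * r - (x ^+ 2 - m ^+ 2)) =
    2 * (x ^+ 2 * (m * r)) - 2 * (x ^+ 2 * (x - m)) + (x - m) ^+ 2 * (2 * x + m) by ring.
by lra.
Qed.

End Logarithm.

Section Entropy.
Variable R : realType.

Lemma sum_sqr_eq0 (I : finType) (P : pred I) (X : I -> R) i :
  \sum_(i | P i) X i ^+ 2 = 0 -> P i -> X i = 0.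
Proof.
move=> /eqP; rewrite psumr_eq0 => [/allP h Pi|j _]; last exact: sqr_ge0.
by have := h i (mem_index_enum _); rewrite Pi /= sqrf_eq0 => /eqP.
Qed.

(** The Cauchy-Schwarz inequality, from [(r * X i - s * Y i) ^+ 2 >= 0] with [s] and [r] the two
    norms. *)
Lemma sum_mul_le_sqrt (I : finType) (P : pred I) (X Y : I -> R) :
  \sum_(i | P i) X i * Y i
    <= Num.sqrt (\sum_(i | P i) X i ^+ 2) * Num.sqrt (\sum_(i | P i) Y i ^+ 2).
Proof.
set a := \sum_(i | P i) X i ^+ 2; set b := \sum_(i | P i) Y i ^+ 2.
have a0 : 0 <= a by apply: sumr_ge0 => i _; exact: sqr_ge0.
have b0 : 0 <= b by apply: sumr_ge0 => i _; exact: sqr_ge0.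
have [az|an0] := eqVneq a 0.
  by rewrite big1 ?mulr_ge0 ?sqrtr_ge0 // => i Pi; rewrite (sum_sqr_eq0 az Pi) mul0r.
have [bz|bn0] := eqVneq b 0.
  by rewrite big1 ?mulr_ge0 ?sqrtr_ge0 // => i Pi; rewrite (sum_sqr_eq0 bz Pi) mulr0.
set s := Num.sqrt a; set r := Num.sqrt b.
have s0 : 0 < s by rewrite sqrtr_gt0 lt_def an0.
have r0 : 0 < r by rewrite sqrtr_gt0 lt_def bn0.
have sa : s ^+ 2 = a by rewrite sqr_sqrtr.
have rb : r ^+ 2 = b by rewrite sqr_sqrtr.
have : \sum_(i | P i) (2 * s * r) * (X i * Y i)
    <= \sum_(i | P i) (r ^+ 2 * X i ^+ 2 + s ^+ 2 * Y i ^+ 2).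
  apply: ler_sum => i _; rewrite -subr_ge0.
  have -> : r ^+ 2 * X i ^+ 2 + s ^+ 2 * Y i ^+ 2 - 2 * s * r * (X i * Y i)
    = (r * X i - s * Y i) ^+ 2 by ring.
  exact: sqr_ge0.
rewrite big_split /= -!mulr_sumr -/a -/b -sa -rb => h.
have sr0 : 0 < 2 * s * r by rewrite !mulr_gt0.
rewrite -(ler_pM2l sr0); apply: le_trans h _.
by have -> : r ^+ 2 * s ^+ 2 + s ^+ 2 * r ^+ 2 = 2 * s * r * (s * r) by ring.
Qed.

(** The reverse triangle inequality for the Euclidean norm, squared. *)
Lemma sqrt_sum_sub_sqr (I : finType) (P : pred I) (X Y : I -> R) :
  (Num.sqrt (\sum_(i | P i) X i ^+ 2) - Num.sqrt (\sum_(i | P i) Y i ^+ 2)) ^+ 2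
    <= \sum_(i | P i) (X i - Y i) ^+ 2.
Proof.
have h := sum_mul_le_sqrt P X Y.
have -> : \sum_(i | P i) (X i - Y i) ^+ 2
   = \sum_(i | P i) X i ^+ 2 + \sum_(i | P i) Y i ^+ 2
     - 2 * \sum_(i | P i) X i * Y i.
  rewrite mulr_sumr -big_split -sumrB /=; apply: eq_bigr => i _; ring.
have /sqr_sqrtr : 0 <= \sum_(i | P i) X i ^+ 2 by apply: sumr_ge0 => i _; exact: sqr_ge0.
have /sqr_sqrtr : 0 <= \sum_(i | P i) Y i ^+ 2 by apply: sumr_ge0 => i _; exact: sqr_ge0.
set s := Num.sqrt (\sum_(i | P i) X i ^+ 2); set r := Num.sqrt (\sum_(i | P i) Y i ^+ 2).
move=> <- <-.
by rewrite sqrrB; move: h; rewrite -/s -/r mulr2n; lra.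
Qed.

(* The entropy is not normalised: it is #|D| times the usual one. *)
Definition ent (T : finType) (D : {pred T}) (f : T -> R) : R :=
  \sum_(x in D) f x * ln (f x)
  - (\sum_(x in D) f x) * ln ((\sum_(x in D) f x) / #|D|%:R).

(** A variance is half the mean squared difference of two independent samples, that is, a Dirichlet
    form on the complete graph. *)
Lemma sum_weighted_variance (I : finType) (w G : I -> R) (N mu : R) :
  \sum_c w c = N -> \sum_c w c * G c = N * mu -> N != 0 ->
  \sum_c w c * (G c - mu) ^+ 2
    = (2 * N)^-1 * \sum_c \sum_d w c * w d * (G c - G d) ^+ 2.
Proof.
move=> wN wG N0.
have -> : \sum_c \sum_d w c * w d * (G c - G d) ^+ 2
  = 2 * (N * \sum_c w c * G c ^+ 2 - (N * mu) ^+ 2).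
  have e c : \sum_d w c * w d * (G c - G d) ^+ 2
      = N * (w c * G c ^+ 2) + w c * (\sum_d w d * G d ^+ 2) - 2 * (N * mu) * (w c * G c).
    have -> : N * (w c * G c ^+ 2) = \sum_d w c * G c ^+ 2 * w d.
      by rewrite -mulr_sumr wN mulrC.
    have -> : 2 * (N * mu) * (w c * G c) = \sum_d 2 * (w c * G c) * (w d * G d).
      by rewrite -mulr_sumr wG; ring.
    by rewrite mulr_sumr -big_split -sumrB; apply: eq_bigr => d _ /=; ring.
  under eq_bigr => c _ do rewrite e.
  by rewrite sumrB big_split /= -!mulr_sumr -mulr_suml wN wG; ring.
have -> : \sum_c w c * (G c - mu) ^+ 2
  = \sum_c w c * G c ^+ 2 - N * mu ^+ 2.
  have e c : w c * (G c - mu) ^+ 2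
      = w c * G c ^+ 2 - 2 * mu * (w c * G c) + mu ^+ 2 * w c by ring.
  under eq_bigr => c _ do rewrite e.
  by rewrite big_split sumrB /= -!mulr_sumr wN wG; ring.
by field.
Qed.

(** The entropy of [G ^+ 2] is at most its mean Bregman divergence from any constant, here
    [mu ^+ 2]. Then [sqr_ln_le] applies at each [c] with [K = N / w c], because [w c * G c] is one
    summand of [N * mu]. *)
Lemma log_sobolev_complete (I : finType) (w G : I -> R) (N L : R) :
  0 < N -> \sum_c w c = N -> (forall c, 0 <= w c) -> (forall c, 0 <= G c) ->
  0 <= L -> (forall c, 0 < w c -> ln (N / w c) <= L) ->
  \sum_c w c * (G c ^+ 2 * ln (G c ^+ 2))
    - (\sum_c w c * G c ^+ 2) * ln ((\sum_c w c * G c ^+ 2) / N)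
  <= (3 + 2 * L) * ((2 * N)^-1 * \sum_c \sum_d w c * w d * (G c - G d) ^+ 2).
Proof.
move=> N0 wN w0 G0 L0 wL.
set F := \sum_c w c * G c ^+ 2.
pose mu := (\sum_c w c * G c) / N.
have Nmu : \sum_c w c * G c = N * mu by rewrite /mu mulrC divfK // gt_eqF.
have mu0 : 0 <= mu.
  by rewrite divr_ge0 ?(ltW N0) // sumr_ge0 // => c _; rewrite mulr_ge0.
rewrite -(sum_weighted_variance wN Nmu (lt0r_neq0 N0)).
have F0 : 0 <= F by apply: sumr_ge0 => c _; rewrite mulr_ge0 ?sqr_ge0.
have [muz|mun0] := eqVneq mu 0.
  have wG c : w c * G c = 0.
    apply/eqP; move: Nmu; rewrite muz mulr0 => /eqP.
    rewrite psumr_eq0 => [/allP h|d _]; last by rewrite mulr_ge0.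
    by have := h c (mem_index_enum _).
  have wG2 c : w c * G c ^+ 2 = 0 by rewrite expr2 mulrA wG mul0r.
  have -> : F = 0 by rewrite /F big1.
  rewrite big1 => [|c _]; last by rewrite mulrA wG2 mul0r.
  rewrite mul0r subr0 mulr_ge0 //; first by lra.
  by apply: sumr_ge0 => c _; rewrite mulr_ge0 ?sqr_ge0.
have mup : 0 < mu by rewrite lt_def mun0.
have tang : F * ln (mu ^+ 2) + F - N * mu ^+ 2 <= F * ln (F / N).
  have /(_ _) := @ln_tangent R (F / N) (mu ^+ 2).
  rewrite divr_ge0 ?(ltW N0) // exprn_gt0 // => /(_ isT isT).
  rewrite -(ler_pM2l N0); congr (_ <= _); by field; lra.
apply: le_trans (_ : \sum_c w c * (G c ^+ 2 * ln (G c ^+ 2) - G c ^+ 2 * ln (mu ^+ 2)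
   - G c ^+ 2 + mu ^+ 2) <= _).
  have e c : w c * (G c ^+ 2 * ln (G c ^+ 2) - G c ^+ 2 * ln (mu ^+ 2) - G c ^+ 2 + mu ^+ 2)
      = w c * (G c ^+ 2 * ln (G c ^+ 2)) - ln (mu ^+ 2) * (w c * G c ^+ 2)
        - w c * G c ^+ 2 + mu ^+ 2 * w c by ring.
  under [leRHS]eq_bigr => c _ do rewrite e.
  by rewrite big_split !sumrB /= -!mulr_sumr wN -/F; lra.
rewrite mulr_sumr; apply: ler_sum => c _.
have [wz|wn0] := eqVneq (w c) 0; first by rewrite wz !mul0r mulr0.
have wp : 0 < w c by rewrite lt_def wn0 w0.
rewrite mulrCA ler_wpM2l //.
have wleN : w c <= N.
  by rewrite -wN (bigD1 c) //= lerDl sumr_ge0.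
apply: le_trans (_ : (3 + 2 * ln (N / w c)) * (G c - mu) ^+ 2 <= _).
  apply: sqr_ln_le => //; first by rewrite ler_pdivlMr // mul1r.
  rewrite mulrA ler_pdivlMr // [mu * N]mulrC -Nmu mulrC.
  by rewrite (bigD1 c) //= lerDl sumr_ge0 // => d _; rewrite mulr_ge0.
by rewrite ler_wpM2r ?sqr_ge0 //; have := wL c wp; lra.
Qed.

(* Jensen's inequality for [ln] under the measure [h ^+ 2] gives the lower bound
   [m ln (m N / a ^+ 2)] for [m], [a], [N] below; it is linearised by a parameter [s]
   so that it can be summed and averaged. *)
Lemma ent_sqr_ge (T : finType) (D : {pred T}) (h : T -> R) (s : R) :
  (0 < #|D|)%N -> 0 < s ->
  (\sum_(x in D) h x ^+ 2) * (ln s + 1)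
     - s * (\sum_(x in D) `|h x|) ^+ 2 / #|D|%:R
  <= ent D (fun x => h x ^+ 2).
Proof.
move=> D0 s0; rewrite /ent.
set m := \sum_(x in D) h x ^+ 2; set a := \sum_(x in D) `|h x|.
have N0 : 0 < #|D|%:R :> R by rewrite ltr0n.
set N := #|D|%:R in N0 *.
have a0 : 0 <= a by apply: sumr_ge0.
have [az|an0] := eqVneq a 0.
  have h0 x : x \in D -> h x = 0.
    move: az => /eqP; rewrite psumr_eq0 // => /allP hh xD.
    by have := hh x (mem_index_enum _); rewrite xD /= normr_eq0 => /eqP.
  have -> : m = 0 by rewrite /m big1 // => x xD; rewrite h0 // expr0n.
  rewrite big1 => [|x xD]; last by rewrite h0 // expr0n mul0r.
  by rewrite az expr0n /= !mulr0 !mul0r.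
have ap : 0 < a by rewrite lt_def an0.
have mp : 0 < m.
  rewrite lt_def sumr_ge0 ?andbT => [|x _]; last exact: sqr_ge0.
  apply: contraNneq an0 => mz; rewrite /a big1 // => x xD.
  by apply/eqP; rewrite normr_eq0; apply/eqP; exact: (sum_sqr_eq0 mz).
(* This [t] maximises the summed tangent bound [2 (ln t + 1) m - 2 t a]. *)
pose t := m / a; have tp : 0 < t by rewrite divr_gt0.
have pt x : 2 * (ln t + 1) * h x ^+ 2 - 2 * t * `|h x| <= h x ^+ 2 * ln (h x ^+ 2).
  have := ln_tangent (normr_ge0 (h x)) tp.
  have [->|hn0] := eqVneq (h x) 0; first by rewrite normr0 expr0n /= !mul0r !mulr0 subr0.
  have hp : 0 < `|h x| by rewrite normr_gt0.
  rewrite -(real_normK (num_real (h x))) lnXn // mulr2n.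
  rewrite -(ler_pM2l hp); lra.
apply: le_trans (_ : 2 * (ln t + 1) * m - 2 * t * a - m * ln (m / N) <= _); last first.
  by rewrite lerB // !mulr_sumr -sumrB; apply: ler_sum => x _; exact: pt.
have ta : t * a = m by rewrite /t divfK.
pose y := m * N / a ^+ 2.
have yp : 0 < y by rewrite divr_gt0 ?mulr_gt0 ?exprn_gt0.
have lny : ln y = 2 * ln t - ln (m / N).
  have -> : y = t ^+ 2 / (m / N) by rewrite /y /t; field; lra.
  by rewrite ln_div ?posrE ?exprn_gt0 ?divr_gt0 // lnXn // mulr2n; lra.
have hs : ln s + 1 - s / y <= ln y.
  have : ln (s / y) <= s / y - 1 by apply: ln_le_sub1; rewrite divr_gt0.
  by rewrite ln_div ?posrE //; lra.
have : m * (ln s + 1 - s / y) <= m * ln y by rewrite ler_pM2l.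
have -> : m * (ln s + 1 - s / y) = m * (ln s + 1) - s * a ^+ 2 / N.
  by rewrite /y; field; lra.
by rewrite lny -[2 * t * a]mulrA ta; lra.
Qed.

End Entropy.

(** * The multislice and its fibers *)

Section Multislice.
Variables (l n : nat).
Implicit Types (kappa : histogram l) (u : coloring l n).

Lemma multisliceP kappa u :
  reflect (forall c, #|[set j | u j == c]| = kappa c) (u \in multislice n kappa).
Proof. by rewrite inE; apply: (iffP forallP) => h c; apply/eqP. Qed.

Lemma coloring_actM u (s t : 'S_n) : act (act u s) t = act u (t * s)%g.
Proof. by apply/ffunP => j; rewrite !ffunE permM. Qed.

Lemma coloring_act1 u : act u 1%g = u.
Proof. by apply/ffunP => j; rewrite !ffunE perm1. Qed.

Lemma coloring_act_inj (s : 'S_n) : injective (fun u : coloring l n => act u s).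
Proof. by apply: (can_inj (g := fun u => act u s^-1%g)) => u; rewrite coloring_actM mulVg coloring_act1. Qed.

Lemma act_tpermK i j u : act (act u (tperm i j)) (tperm i j) = u.
Proof. by rewrite coloring_actM tperm2 coloring_act1. Qed.

Lemma act_tperm_id u j k : u j = u k -> act u (tperm j k) = u.
Proof. by move=> e; apply/ffunP => i; rewrite ffunE; case: tpermP => // ->. Qed.

Lemma act_multislice kappa u s :
  (act u s \in multislice n kappa) = (u \in multislice n kappa).
Proof.
rewrite !inE; apply: eq_forallb => c; congr (_ == _).
rewrite -[RHS](card_preimset _ (@perm_inj _ s)).
by apply: eq_card => j; rewrite !inE ffunE.
Qed.

Lemma sum_act (V : nmodType) kappa (F : coloring l n -> V) s :
  \sum_(u in multislice n kappa) F (act u s) = \sum_(u in multislice n kappa) F u.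
Proof.
rewrite [RHS](reindex_inj (@coloring_act_inj s)) /=.
by apply: eq_bigl => u; rewrite act_multislice.
Qed.

Lemma hist_le kappa u c : u \in multislice n kappa -> (kappa c <= n)%N.
Proof. by move/multisliceP => <-; rewrite -[leqRHS]card_ord max_card. Qed.

End Multislice.

Section Insertion.
Variables (l n : nat).
Implicit Types (kappa : histogram l) (v : coloring l n).

Definition insert (i : 'I_n.+1) (c : 'I_l) v : coloring l n.+1 :=
  [ffun j => if unlift i j is Some k then v k else c].

Definition decrement kappa (c : 'I_l) : histogram l :=
  [ffun a => (kappa a - (a == c))%N].

Lemma insert_at i c v : insert i c v i = c.
Proof. by rewrite ffunE unlift_none. Qed.

Lemma insert_lift i c v k : insert i c v (lift i k) = v k.
Proof. by rewrite ffunE liftK. Qed.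

Lemma sum_lift (V : nmodType) (i : 'I_n.+1) (F : 'I_n.+1 -> V) :
  \sum_j F (lift i j) = \sum_(j | j != i) F j.
Proof.
rewrite [RHS](reindex_omap (lift i) (unlift i)) => [|j ji]; last first.
  by case: unliftP ji => [k ->//|->]; rewrite eqxx.
by apply: eq_bigl => j; rewrite liftK eqxx andbT eq_sym neq_lift.
Qed.

Lemma insert_act i c v j k :
  insert i c (act v (tperm j k)) = act (insert i c v) (tperm (lift i j) (lift i k)).
Proof.
apply/ffunP => a; rewrite [RHS]ffunE; case: (unliftP i a) => [b ->|->].
  by rewrite insert_lift ffunE -inj_tperm ?insert_lift //; exact: lift_inj.
by rewrite tpermD ?insert_at // eq_sym neq_lift.
Qed.

Lemma insert_multislice kappa i c v : (0 < kappa c)%N ->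
  (insert i c v \in multislice n.+1 kappa) = (v \in multislice n (decrement kappa c)).
Proof.
move=> kc; rewrite !inE; apply: eq_forallb => a; rewrite ffunE.
have -> : #|[set j | insert i c v j == a]| = ((c == a) + #|[set j | v j == a]|)%N.
  rewrite -!sum1dep_card big_mkcond (bigD1_ord i) //= insert_at [in RHS]big_mkcond.
  congr (_ + _)%N.
  by apply: eq_bigr => j _; rewrite insert_lift.
have [->|_] := eqVneq a c; last by rewrite subn0.
by case: (kappa c) kc => // k _; rewrite subn1.
Qed.

Definition fiber (m : nat) kappa (i : 'I_m) (c : 'I_l) : {set coloring l m} :=
  [set u in multislice m kappa | u i == c].

Lemma in_fiber (m : nat) kappa (i : 'I_m) (c : 'I_l) (u : coloring l m) :
  (u \in fiber kappa i c) = (u \in multislice m kappa) && (u i == c).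
Proof. by rewrite in_set. Qed.

Lemma sum_fiber_insert (V : nmodType) kappa i c (F : coloring l n.+1 -> V) :
  (0 < kappa c)%N ->
  \sum_(u in fiber kappa i c) F u
    = \sum_(v in multislice n (decrement kappa c)) F (insert i c v).
Proof.
move=> kc.
pose remove (u : coloring l n.+1) : coloring l n := [ffun k => u (lift i k)].
rewrite (reindex_onto (insert i c) remove) => [|u]; last first.
  rewrite in_fiber => /andP[_ /eqP uc]; apply/ffunP => a.
  by case: (unliftP i a) => [b ->|->]; rewrite ?insert_lift ?insert_at // ffunE.
apply: eq_bigl => v; rewrite in_fiber insert_multislice // insert_at eqxx andbT.
rewrite (_ : _ == v) ?andbT //; apply/eqP/ffunP => k.
by rewrite ffunE insert_lift.
Qed.

End Insertion.

Section Fibers.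
Variables (R : realType) (l n : nat) (kappa : histogram l).
Let U := multislice n kappa.
Implicit Types (u : coloring l n) (g : coloring l n -> R).

Lemma sum_fibers (V : nmodType) i (F : coloring l n -> V) :
  \sum_(c < l) \sum_(u in fiber kappa i c) F u = \sum_(u in U) F u.
Proof.
rewrite [RHS](partition_big (fun u : coloring l n => u i) predT) //=.
by apply: eq_bigr => c _; apply: eq_bigl => u; rewrite in_fiber.
Qed.

Lemma fiber_tperm i j c u : (act u (tperm i j) \in fiber kappa i c) = (u \in fiber kappa j c).
Proof. by rewrite !in_fiber act_multislice ffunE tpermL. Qed.

(** Swapping two coordinates shows that the size of the fiber does not depend on [i]; then the pairs
    [(u, j)] with [u j = c] are counted in two ways. *)
Lemma card_fiber (i : 'I_n) c : #|fiber kappa i c|%:R * n%:R = #|U|%:R * (kappa c)%:R :> R.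
Proof.
rewrite -!natrM; congr _%:R.
transitivity (\sum_(j < n) #|fiber kappa j c|)%N.
  transitivity (\sum_(j < n) #|fiber kappa i c|)%N.
    by rewrite sum_nat_const card_ord mulnC.
  apply: eq_bigr => j _.
  rewrite -!sum1_card (reindex_inj (@coloring_act_inj l n (tperm i j))) /=.
  by apply: eq_bigl => u; rewrite fiber_tperm.
transitivity (\sum_(j < n) \sum_(u in U) (u j == c))%N.
  apply: eq_bigr => j _; rewrite -sum1_card big_mkcond [RHS]big_mkcond.
  by apply: eq_bigr => u _; rewrite in_fiber; case: (u \in _); case: (u j == c).
rewrite exchange_big /= -sum_nat_const; apply: eq_bigr => u uU.
rewrite -(multisliceP _ _ uU c) -sum1dep_card [RHS]big_mkcond.
by apply: eq_bigr => j _; case: (u j == c).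
Qed.

Lemma sum_color u c (x : R) : u \in U -> \sum_(j | u j == c) x = (kappa c)%:R * x.
Proof.
move=> uU; rewrite sumr_const mulr_natl -(multisliceP _ _ uU c).
by congr (_ *+ _); apply: eq_card => j; rewrite inE.
Qed.

Lemma sum_fiber_pairs (i : 'I_n) c d (F : coloring l n -> R) :
  \sum_(x : coloring l n * 'I_n | (x.1 \in fiber kappa i c) && (x.1 x.2 == d)) F x.1
    = (kappa d)%:R * \sum_(u in fiber kappa i c) F u.
Proof.
rewrite -(pair_big_dep [in fiber kappa i c] (fun u j => u j == d) (fun u j => F u)) /=.
rewrite mulr_sumr.
by apply: eq_bigr => u; rewrite in_fiber => /andP[uU _]; exact: sum_color.
Qed.

(** The involution [(u, j) -> (act u (tperm i j), j)] exchanges the pairs with [u i = c], [u j = d]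
    and those with [u i = d], [u j = c]. *)
Lemma sum_fiber_pairs_tperm (i : 'I_n) c d (F : coloring l n -> R) :
  \sum_(x : coloring l n * 'I_n | (x.1 \in fiber kappa i c) && (x.1 x.2 == d))
      F (act x.1 (tperm i x.2))
    = (kappa c)%:R * \sum_(u in fiber kappa i d) F u.
Proof.
rewrite -sum_fiber_pairs.
pose h (x : coloring l n * 'I_n) := (act x.1 (tperm i x.2), x.2).
have hK : involutive h by case=> u j; rewrite /h /= act_tpermK.
rewrite (reindex_inj (inv_inj hK)) /=; apply: eq_big => [[u j]|[u j] _] /=.
  by rewrite !in_fiber act_multislice !ffunE tpermL tpermR -!andbA [(u j == c) && _]andbC.
by rewrite act_tpermK.
Qed.

End Fibers.

(** * Log-Sobolev inequality for random transpositions *)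

Section LogSobolev.
Variable R : realType.

Definition swap_energy (l n : nat) (kappa : histogram l) (g : coloring l n -> R)
    (j k : 'I_n) : R :=
  \sum_(u in multislice n kappa) (g u - g (act u (tperm j k))) ^+ 2.

(** The unnormalised Dirichlet form of random transpositions: each transposition is counted twice,
    and the diagonal contributes 0. *)
Definition energy (l n : nat) (kappa : histogram l) (g : coloring l n -> R) : R :=
  \sum_j \sum_k swap_energy kappa g j k.

Section Projection.
Variables (l n : nat) (kappa : histogram l) (g : coloring l n -> R) (i : 'I_n).
Hypothesis U0 : (0 < #|multislice n kappa|)%N.
Let N : R := #|multislice n kappa|%:R.
Let w (c : 'I_l) : R := #|fiber kappa i c|%:R.
Let F (c : 'I_l) : R := \sum_(u in fiber kappa i c) g u ^+ 2.
Let G (c : 'I_l) : R := Num.sqrt (F c / w c).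

Let N_gt0 : 0 < N. Proof. by rewrite ltr0n. Qed.
Let n_gt0 : 0 < n%:R :> R. Proof. by rewrite ltr0n; case: i => j; case: n. Qed.

Let wE c : w c = N * (kappa c)%:R / n%:R.
Proof. by rewrite -(card_fiber R kappa i c) mulfK // gt_eqF. Qed.

Let F_ge0 c : 0 <= F c. Proof. by apply: sumr_ge0 => u _; exact: sqr_ge0. Qed.

Let wG c : w c * G c ^+ 2 = F c.
Proof.
rewrite sqr_sqrtr ?divr_ge0 //; have [wz|w0] := eqVneq (w c) 0; last by rewrite mulrC divfK.
rewrite wz mul0r /F big_pred0 // => u.
by move: wz => /eqP; rewrite pnatr_eq0 cards_eq0 => /eqP ->; rewrite inE.
Qed.

(* Swapping coordinates [i] and [j] couples the fibers over [c] and [d]. *)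
Let fiber_coupling c d :
  w c * w d * (G c - G d) ^+ 2
    <= N / n%:R * \sum_(u in fiber kappa i c) \sum_(j | u j == d)
         (g u - g (act u (tperm i j))) ^+ 2.
Proof.
have rhs0 : 0 <= N / n%:R * \sum_(u in fiber kappa i c) \sum_(j | u j == d)
    (g u - g (act u (tperm i j))) ^+ 2.
  rewrite mulr_ge0 ?divr_ge0 ?ler0n ?(ltW N_gt0) //.
  by do 2!(apply: sumr_ge0 => ? _); exact: sqr_ge0.
(* The number of pairs [(u, j)] with [u i = c] and [u j = d], symmetric in [c] and [d]. Both root
   mean squares thus become norms over one index set, and the reverse triangle inequality compares
   them. *)
pose m := N * (kappa c)%:R * (kappa d)%:R / n%:R.
have mw : m = (kappa d)%:R * w c by rewrite /m wE; ring.
have mw' : m = (kappa c)%:R * w d by rewrite /m wE; ring.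
have -> : w c * w d = N / n%:R * m by rewrite /m !wE; ring.
rewrite -mulrA ler_wpM2l ?divr_ge0 ?ler0n ?(ltW N_gt0) //.
have m0 : 0 <= m by rewrite mw mulr_ge0.
have -> : m * (G c - G d) ^+ 2
    = (Num.sqrt ((kappa d)%:R * F c) - Num.sqrt ((kappa c)%:R * F d)) ^+ 2.
  rewrite -(wG c) -(wG d) (mulrA (kappa d)%:R) (mulrA (kappa c)%:R) -mw -mw' !(sqrtrM _ m0).
  rewrite !sqrtr_sqr !ger0_norm ?sqrtr_ge0 //.
  by rewrite -mulrBr exprMn sqr_sqrtr.
rewrite -(sum_fiber_pairs kappa i c d (fun u => g u ^+ 2)).
rewrite -(sum_fiber_pairs_tperm kappa i c d (fun u => g u ^+ 2)).
apply: le_trans (sqrt_sum_sub_sqr _ _ _) _.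
by rewrite -(pair_big_dep [in fiber kappa i c] (fun u j => u j == d)
     (fun u j => (g u - g (act u (tperm i j))) ^+ 2)).
Qed.

(** By the chain rule, the entropy is that within the fibers plus that of the conditional means
    [G c ^+ 2]. The complete graph bounds the latter, and the coupling turns its energy into swaps
    with [i]. *)
Lemma ent_fibers (L : R) :
  0 <= L -> (forall c, (0 < kappa c)%N -> ln n%:R - ln (kappa c)%:R <= L) ->
  ent [in multislice n kappa] (fun u => g u ^+ 2)
  <= \sum_c ent [in fiber kappa i c] (fun u => g u ^+ 2)
     + (3 + 2 * L) / (2 * n%:R) * \sum_j swap_energy kappa g i j.
Proof.
move=> L0 hL.
have wN : \sum_c w c = N.
  under eq_bigr => c _ do rewrite /w -sumr_const.
  by rewrite sum_fibers sumr_const.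
have hw c : 0 < w c -> ln (N / w c) <= L.
  rewrite wE => wp.
  have kc : (0 < kappa c)%N.
    by rewrite lt0n; apply: contraTneq wp => ->; rewrite mulr0 mul0r ltxx.
  rewrite (_ : N / _ = n%:R / (kappa c)%:R).
    by rewrite ln_div ?posrE ?n_gt0 ?ltr0n // hL.
  by field; rewrite !gt_eqF ?n_gt0 ?N_gt0 ?ltr0n.
have w0 c : 0 <= w c by exact: ler0n.
have G0 c : 0 <= G c by exact: sqrtr_ge0.
have := log_sobolev_complete N_gt0 wN w0 G0 L0 hw.
under eq_bigr => c _ do rewrite mulrA wG.
under [\sum_c w c * G c ^+ 2]eq_bigr => c _ do rewrite wG.
have -> : \sum_c F c = \sum_(u in multislice n kappa) g u ^+ 2 by exact: sum_fibers.
rewrite /ent sumrB sum_fibers => h.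
have eF : \sum_c F c * ln (G c ^+ 2) = \sum_c F c * ln (F c / w c).
  by apply: eq_bigr => c _; rewrite sqr_sqrtr // divr_ge0.
rewrite eF in h; rewrite -/N.
set V := \sum_j swap_energy kappa g i j.
have hV : (2 * N)^-1 * (\sum_c \sum_d w c * w d * (G c - G d) ^+ 2) <= (2 * n%:R)^-1 * V.
  have -> : (2 * n%:R)^-1 * V = (2 * N)^-1 * (N / n%:R * V).
    by field; rewrite !gt_eqF.
  rewrite ler_wpM2l ?invr_ge0 ?mulr_ge0 ?(ltW N_gt0) //.
  have -> : V = \sum_c \sum_d \sum_(u in fiber kappa i c) \sum_(j | u j == d)
         (g u - g (act u (tperm i j))) ^+ 2.
    transitivity (\sum_(u in multislice n kappa) \sum_j (g u - g (act u (tperm i j))) ^+ 2).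
      by rewrite exchange_big.
    rewrite -(sum_fibers kappa i).
    apply: eq_bigr => c _; rewrite [RHS]exchange_big /=; apply: eq_bigr => u _.
    by rewrite (partition_big (fun j => u j) predT).
  rewrite mulr_sumr; apply: ler_sum => c _; rewrite mulr_sumr; apply: ler_sum => d _.
  exact: fiber_coupling.
have : (3 + 2 * L) * ((2 * N)^-1 * (\sum_c \sum_d w c * w d * (G c - G d) ^+ 2))
   <= (3 + 2 * L) * ((2 * n%:R)^-1 * V) by rewrite ler_wpM2l //; lra.
rewrite -[(3 + 2 * L) / _ * V]mulrA.
by move: h; rewrite -/N; lra.
Qed.

End Projection.
(* The summand [4 + ln (n / (k + 1))] is chosen so that, times [n], its expected
   decrease when a random coordinate is removed pays for the [ln (n / k)] of the
   complete graph; unlike [ln (n / k)] it makes sense for [k = 0]. *)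
Definition log_sobolev_const (l n : nat) (kappa : histogram l) : R :=
  (\sum_c (4 + ln n%:R - ln (kappa c).+1%:R)) / (n%:R - 1).

Lemma sum_except2 (n : nat) (j k : 'I_n) (x : R) : j != k ->
  \sum_(i | (i != j) && (i != k)) x = (n%:R - 2) * x.
Proof.
move=> jk; have : \sum_(i < n) x = n%:R * x by rewrite sumr_const card_ord mulr_natl.
rewrite (bigD1 j) //= (bigD1 k) 1?eq_sym //= => h.
by rewrite mulrBl -h; ring.
Qed.

Lemma ln_succ_sub k : (0 < k)%N -> ln k.+1%:R - ln k%:R <= k%:R^-1 :> R.
Proof.
move=> k0; rewrite -ln_div ?posrE ?ltr0n //.
apply: le_trans (ln_le_sub1 _) _; first by rewrite divr_gt0 ?ltr0n.
by rewrite -natr1 mulrDl divff ?pnatr_eq0 -?lt0n // mul1r addrAC subrr add0r.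
Qed.

(** Only the [kappa c] coordinates of color [c] contribute, each at most [1 / kappa c]. *)
Lemma sum_decrement_ln (l n : nat) (kappa : histogram l) (u : coloring l n)
    (P : pred 'I_n) (c : 'I_l) :
  u \in multislice n kappa ->
  \sum_(i | P i) (ln (kappa c).+1%:R - ln (decrement kappa (u i) c).+1%:R) <= 1 :> R.
Proof.
move=> uU.
apply: le_trans (_ : \sum_(i | u i == c) (kappa c)%:R^-1 <= 1); last first.
  rewrite (sum_color _ _ uU); have [->|k0] := eqVneq (kappa c) 0%N; first by rewrite mul0r.
  by rewrite divff // pnatr_eq0.
rewrite big_mkcond [leRHS]big_mkcond; apply: ler_sum => i _; rewrite ffunE [c == _]eq_sym.
have [uc|_] := eqVneq (u i) c; last by rewrite subn0 subrr; case: ifP.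
have k0 : (0 < kappa c)%N.
  by rewrite -(multisliceP _ _ uU c) card_gt0; apply/set0Pn; exists i; rewrite inE uc.
case: ifP => _; last by rewrite invr_ge0.
by rewrite subn1 prednK // ln_succ_sub.
Qed.

(** The recursion seen by one pair [j], [k] of distinct colors: it survives the conditioning on each
    of the [n - 1] other coordinates, and the second summand is the cost of the complete graph. *)
Lemma log_sobolev_const_step (l n : nat) (kappa : histogram l) (u : coloring l n.+1) j k :
  (2 <= l)%N -> u \in multislice n.+1 kappa -> u j != u k ->
  \sum_(i | (i != j) && (i != k)) log_sobolev_const n (decrement kappa (u i))
    + (3 + 2 * \sum_c (ln 2 + ln n.+1%:R - ln (kappa c).+1%:R)) / (2 * n.+1%:R)
  <= n.+1%:R * log_sobolev_const n.+1 kappa.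
Proof.
move=> l2 uU ujk.
have jk : j != k by apply: contraNneq ujk => ->.
have n0 : (0 < n)%N.
  by case: n u j k uU ujk jk => // u j k _ _; rewrite !ord1 eqxx.
have nR : 1 <= n%:R :> R by rewrite ler1n.
have mE : n.+1%:R = n%:R + 1 :> R by rewrite natr1.
pose Y c : R := ln n.+1%:R - ln (kappa c).+1%:R.
have Y1 c : -1 <= Y c.
  have h : ln n.+2%:R - ln n.+1%:R <= 1 :> R.
    by apply: le_trans (ln_succ_sub _) _; rewrite // invf_le1 ?ltr0n // ler1n.
  have : ln (kappa c).+1%:R <= ln n.+2%:R :> R.
    by rewrite ler_ln ?posrE ?ltr0n // ler_nat !ltnS (hist_le _ uU).
  by rewrite /Y; lra.
have ln2 : ln 2 <= 1 :> R by have := @ln_le_sub1 R 2; lra.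
have ln2' : 0 <= ln 2 :> R by rewrite ln_ge0 // ler1n.
have lnn : ln n%:R <= ln n.+1%:R :> R by rewrite ler_ln ?posrE ?ltr0n // ler_nat.
have lR : 2 <= l%:R :> R by rewrite ler_nat.
(* Each color leaves a surplus [4 - 2 ln 2 >= 2], so two colors already absorb the 3. *)
have L3 : 3 + 2 * (\sum_c (ln 2 + ln n.+1%:R - ln (kappa c).+1%:R))
   <= \sum_c (4 + 2 * Y c).
  rewrite mulr_sumr -lerBrDr -sumrB.
  apply: le_trans (_ : \sum_(c < l) 2 <= _).
    by rewrite sumr_const card_ord -mulr_natl; lra.
  by apply: ler_sum => c _; rewrite /Y; lra.
apply: le_trans (_ : \sum_(i | (i != j) && (i != k)) log_sobolev_const n (decrement kappa (u i))
    + (\sum_c (4 + 2 * Y c)) / (2 * n.+1%:R) <= _).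
  by rewrite lerD2l ler_wpM2r // invr_ge0 mulr_ge0.
have S : \sum_(i | (i != j) && (i != k)) log_sobolev_const n (decrement kappa (u i))
   <= \sum_c (4 + Y c + 2 / n%:R).
  rewrite /log_sobolev_const -mulr_suml.
  (* For [n = 1] the constants on the left are 0, as quotients by 0. *)
  have [n1|n1] := eqVneq n 1%N.
    have -> : n%:R - 1 = 0 :> R by rewrite n1 subrr.
    rewrite invr0 mulr0; apply: sumr_ge0 => c _.
    by apply: addr_ge0; rewrite ?divr_ge0 //; have := Y1 c; lra.
  have n2 : 2 <= n%:R :> R by rewrite ler_nat ltn_neqAle eq_sym n1.
  rewrite ler_pdivrMr; last lra.
  rewrite exchange_big /= mulr_suml; apply: ler_sum => c _.
  have h := sum_decrement_ln [pred i | (i != j) && (i != k)] c uU.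
  have -> : \sum_(i | (i != j) && (i != k)) (4 + ln n%:R - ln (decrement kappa (u i) c).+1%:R)
    = (n%:R - 1) * (4 + ln n%:R - ln (kappa c).+1%:R)
      + \sum_(i | [pred i | (i != j) && (i != k)] i)
           (ln (kappa c).+1%:R - ln (decrement kappa (u i) c).+1%:R) :> R.
    have -> : n%:R - 1 = n.+1%:R - 2 :> R by rewrite mE; ring.
    rewrite -(sum_except2 _ jk) -big_split /=; apply: eq_bigr => i _; ring.
  have h2 : (n%:R - 1) * (4 + ln n%:R - ln (kappa c).+1%:R) <= (n%:R - 1) * (4 + Y c).
    by rewrite ler_wpM2l //; rewrite /Y; lra.
  have h3 : 1 <= 2 / n%:R * (n%:R - 1) :> R.
    by rewrite mulrAC ler_pdivlMr; lra.
  by move: h h2 h3; rewrite mulrDl; lra.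
apply: le_trans (lerD S (lexx _)) _.
rewrite /log_sobolev_const mulrCA !mulr_suml -big_split /=.
apply: ler_sum => c _.
have -> : 4 + ln n.+1%:R - ln (kappa c).+1%:R = 4 + Y c by rewrite /Y; ring.
have h1 : (4 + 2 * Y c) / (2 * n.+1%:R) <= (2 + Y c) / n%:R.
  rewrite (_ : _ / _ = (2 + Y c) / n.+1%:R); last by field; lra.
  rewrite ler_wpM2l //; first by have := Y1 c; lra.
  by rewrite lef_pV2 ?posrE ?ltr0n // ler_nat.
(* The excess over [4 + Y c] splits into [2 / n], for the change of histograms in [S], and
   [(2 + Y c) / n], for the complete graph. *)
have -> : (4 + Y c) * (n.+1%:R / (n.+1%:R - 1)) = 4 + Y c + 2 / n%:R + (2 + Y c) / n%:R.
  by rewrite mE; field; lra.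
by rewrite lerD2l.
Qed.

End LogSobolev.

Section LogSobolev.
Variable R : realType.

Lemma ent_pred0 (T : finType) (D : {pred T}) (f : T -> R) : D =1 pred0 -> ent D f = 0.
Proof. by move=> D0; rewrite /ent !big_pred0 // mul0r subrr. Qed.

Lemma fiber_color_gt0 (l n : nat) (kappa : histogram l) (i : 'I_n) c u :
  u \in fiber kappa i c -> (0 < kappa c)%N.
Proof.
rewrite in_fiber => /andP[uU /eqP uc]; rewrite -(multisliceP _ _ uU c) card_gt0.
by apply/set0Pn; exists i; rewrite inE uc.
Qed.

Lemma ent_fiber_insert (l n : nat) (kappa : histogram l) (i : 'I_n.+1) c
    (f : coloring l n.+1 -> R) :
  (0 < kappa c)%N ->
  ent [in fiber kappa i c] f
    = ent [in multislice n (decrement kappa c)] (fun v => f (insert i c v)).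
Proof.
move=> kc; rewrite /ent !sum_fiber_insert //; congr (_ - _ * ln (_ / _%:R)).
by rewrite -!sum1_card; exact: (sum_fiber_insert i (fun=> 1%N) kc).
Qed.

Lemma energy_insert (l n : nat) (kappa : histogram l) (i : 'I_n.+1) c
    (g : coloring l n.+1 -> R) :
  (0 < kappa c)%N ->
  energy (decrement kappa c) (fun v => g (insert i c v))
  = \sum_(j | j != i) \sum_(k | k != i)
      \sum_(u in fiber kappa i c) (g u - g (act u (tperm j k))) ^+ 2.
Proof.
move=> kc; rewrite -sum_lift; apply: eq_bigr => j _; rewrite -sum_lift.
apply: eq_bigr => k _; rewrite sum_fiber_insert //.
by apply: eq_bigr => v _; rewrite insert_act.
Qed.

(** The bounds obtained by conditioning on [i] are summed over all [i]: the coupling energies add up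
    to the whole energy, and the coefficients are compared for each [u], [j], [k] separately. *)
Theorem log_sobolev_multislice (l n : nat) (kappa : histogram l) (g : coloring l n -> R) :
  (2 <= l)%N ->
  ent [in multislice n kappa] (fun u => g u ^+ 2)
    <= log_sobolev_const R n kappa * energy kappa g.
Proof.
move=> l2; elim: n kappa g => [|n IH] kappa g.
  rewrite /energy big_ord0 mulr0.
  have [U0|/set0Pn[u uU]] := eqVneq (multislice 0 kappa) set0.
    by rewrite ent_pred0 // => u; rewrite U0 inE.
  have uE v : v = u by apply/ffunP => -[].
  have Uu : multislice 0 kappa = [set u].
    by apply/setP => v; rewrite (uE v) uU set11.
  by rewrite /ent Uu !big_set1 cards1 divr1 subrr.
have [U0|U0] := posnP #|multislice n.+1 kappa|.
  move/eqP: U0; rewrite cards_eq0 => /eqP U0.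
  rewrite ent_pred0 => [|u]; last by rewrite U0 inE.
  rewrite /energy big1 ?mulr0 // => j _; rewrite big1 // => k _.
  by rewrite /swap_energy U0 big_set0.
(* A sum over colors in place of the maximum of [ln (n.+1 / kappa c)]. The [ln 2] makes every
   summand nonnegative and pays for passing from [kappa c] to its successor. *)
pose L : R := \sum_c (ln 2 + ln n.+1%:R - ln (kappa c).+1%:R).
have kn c : (kappa c <= n.+1)%N.
  by move: U0; rewrite card_gt0 => /set0Pn[u /hist_le].
have L0c c : 0 <= ln 2 + ln n.+1%:R - ln (kappa c).+1%:R :> R.
  rewrite subr_ge0 -lnM ?posrE ?ltr0n // ler_ln ?posrE ?mulr_gt0 ?ltr0n //.
  by rewrite -natrM ler_nat; have := kn c; lia.
have L0 : 0 <= L by apply: sumr_ge0.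
have hL c : (0 < kappa c)%N -> ln n.+1%:R - ln (kappa c)%:R <= L.
  move=> kc; rewrite /L (bigD1 c) //=.
  have h : ln (kappa c).+1%:R <= ln 2 + ln (kappa c)%:R :> R.
    rewrite -lnM ?posrE ?ltr0n // ler_ln ?posrE ?mulr_gt0 ?ltr0n //.
    by rewrite -natrM ler_nat; lia.
  have : 0 <= \sum_(d < l | d != c) (ln 2 + ln n.+1%:R - ln (kappa d).+1%:R) :> R.
    by apply: sumr_ge0.
  by lra.
have fib i c : ent [in fiber kappa i c] (fun u => g u ^+ 2)
   <= \sum_(j | j != i) \sum_(k | k != i) \sum_(u in fiber kappa i c)
       log_sobolev_const R n (decrement kappa (u i)) * (g u - g (act u (tperm j k))) ^+ 2.
  have [/eqP|] := posnP (kappa c).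
    move=> kc; have f0 u : (u \in fiber kappa i c) = false.
      by apply: contraTF kc => /fiber_color_gt0; rewrite lt0n.
    rewrite ent_pred0 // big1 // => j _; rewrite big1 // => k _.
    by rewrite big_pred0.
  move=> kc; rewrite ent_fiber_insert //; apply: le_trans (IH _ _) _.
  rewrite (energy_insert i g kc) mulr_sumr; apply: ler_sum => j _.
  rewrite mulr_sumr; apply: ler_sum => k _; rewrite mulr_sumr; apply: ler_sum => u.
  by rewrite in_fiber => /andP[_ /eqP ->].
pose X u (j k : 'I_n.+1) := (g u - g (act u (tperm j k))) ^+ 2.
have step i : ent [in multislice n.+1 kappa] (fun u => g u ^+ 2)
  <= \sum_(j | j != i) \sum_(k | k != i) \sum_(u in multislice n.+1 kappa)
       log_sobolev_const R n (decrement kappa (u i)) * X u j k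
     + (3 + 2 * L) / (2 * n.+1%:R) * \sum_j swap_energy kappa g i j.
  apply: le_trans (ent_fibers g i U0 L0 hL) _; rewrite lerD2r.
  apply: le_trans (ler_sum _ (fun c _ => fib i c)) _.
  rewrite exchange_big /=; apply: ler_sum => j _.
  rewrite exchange_big /=; apply: ler_sum => k _.
  by rewrite sum_fibers.
have n0 : 0 < n.+1%:R :> R by rewrite ltr0n.
rewrite -(ler_pM2l n0) mulrA mulr_natl -[X in _ *+ X]card_ord -sumr_const.
apply: le_trans (ler_sum _ (fun i _ => step i)) _.
rewrite big_split /= -mulr_sumr -/(energy kappa g).
have -> : \sum_i \sum_(j | j != i) \sum_(k | k != i) \sum_(u in multislice n.+1 kappa)
     log_sobolev_const R n (decrement kappa (u i)) * X u j k
   = \sum_j \sum_k \sum_(u in multislice n.+1 kappa)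
      (\sum_(i | (i != j) && (i != k)) log_sobolev_const R n (decrement kappa (u i))) * X u j k.
  rewrite (exchange_big_dep predT) //=; apply: eq_bigr => j _.
  rewrite (exchange_big_dep predT) //=; apply: eq_bigr => k _.
  rewrite exchange_big /=; apply: eq_bigr => u _; rewrite mulr_suml.
  by apply: eq_bigl => i; rewrite ![_ == i]eq_sym.
rewrite /energy !mulr_sumr -big_split; apply: ler_sum => j _ /=.
rewrite !mulr_sumr -big_split; apply: ler_sum => k _ /=.
rewrite !mulr_sumr -big_split; apply: ler_sum => u uU /=.
(* Swapping equal colors changes nothing, so the recursion is needed for distinct colors only. *)
have [e|ne] := eqVneq (u j) (u k).
  by rewrite /X act_tperm_id // subrr expr0n /= !mulr0 addr0.
rewrite -mulrDl ler_wpM2r ?sqr_ge0 // -mulr_sumr.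
exact: log_sobolev_const_step.
Qed.

End LogSobolev.

(** * Averaging over subgroups of permutations *)

Section Averaging.
Variables (R : realType) (l n : nat).
Local Notation X := (coloring l n).
Implicit Types (f g h : X -> R) (S : {set 'I_n}) (s t : 'S_n).

Definition shift s f : X -> R := fun u => f (act u s).

(** The conditional expectation of [f] given the coordinates outside [S]: the orbit of [u] under
    [Sym S] consists of its rearrangements within [S]. *)
Definition average S f : X -> R :=
  fun u => #|Sym S|%:R^-1 * \sum_(s in Sym S) shift s f u.

Lemma act_tpermC (u : X) j k s :
  act (act u (tperm j k)) s = act (act u s) (tperm (s^-1 j)%g (s^-1 k)%g).
Proof. by rewrite -tpermJ !coloring_actM /conjg invgK mulgA mulgKV. Qed.

Lemma shift_average S s f u : s \in Sym S -> shift s (average S f) u = average S f u.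
Proof.
move=> sS; rewrite /shift /average; congr (_ * _).
rewrite [RHS](reindex_inj (mulIg s)) /=; apply: eq_big => t.
  by rewrite groupMr.
by rewrite /shift coloring_actM.
Qed.

Lemma average0 f u : average set0 f u = f u.
Proof.
have S0 : Sym set0 = [set 1%g] :> {set 'S_n}.
  apply/setP => s; rewrite inE in_set1; apply/idP/eqP => [s0|->]; last exact: perm_on1.
  by apply/permP => i; rewrite perm1 (out_perm s0) ?inE.
by rewrite /average S0 big_set1 cards1 invr1 mul1r /shift coloring_act1.
Qed.

(** Only the linearity needed below is required: differences and averages. The inner product and the
    Dirichlet form are both instances, so the decomposition is orthogonal for both at once. *)
Record invariant_form (B : (X -> R) -> (X -> R) -> R) := InvariantForm {
  form_eq : forall f g h, f =1 g -> B f h = B g h;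
  form_sym : forall f g, B f g = B g f;
  form_sub : forall f g h, B (fun u => f u - g u) h = B f h - B g h;
  form_avg : forall (A : {set 'S_n}) c (F : 'S_n -> X -> R) h,
    B (fun u => c * \sum_(s in A) F s u) h = c * \sum_(s in A) B (F s) h;
  form_shift : forall s f g, B (shift s f) (shift s g) = B f g }.

Section Form.
Variables (B : (X -> R) -> (X -> R) -> R) (HB : invariant_form B).

(** By invariance each shift can be moved to the second argument, which [Sym S] fixes. *)
Lemma form_average S S' f : Sym S' \subset Sym S ->
  B (average S' f) (average S f) = B f (average S f).
Proof.
move=> sub; rewrite (form_avg HB).
rewrite (eq_bigr (fun=> B f (average S f))) => [|s sS'].
  rewrite sumr_const -[X in _ * X]mulr_natl mulrA mulVf ?mul1r // pnatr_eq0 -lt0n.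
  exact: cardG_gt0.
rewrite -[RHS](form_shift HB s) [RHS](form_sym HB) [LHS](form_sym HB).
by apply: (form_eq HB) => u; rewrite shift_average // (subsetP sub).
Qed.

(* Pythagoras: [average S] is the orthogonal projection onto the functions
   invariant under [Sym S], for every invariant form. *)
Lemma form_average_sub S S' f : Sym S' \subset Sym S ->
  let d u := average S' f u - average S f u in
  B d d = B (average S' f) (average S' f) - B (average S f) (average S f).
Proof.
move=> sub /=; set d := fun u => _.
rewrite (form_sub HB) ![B _ d](form_sym HB) !(form_sub HB).
rewrite (form_sym HB (average S f) (average S' f)) (form_average _ sub).
by rewrite -(form_average f (subxx _)); ring.
Qed.

End Form.

Variable kappa : histogram l.
Local Notation U := (multislice n kappa).

Definition dot f g : R := \sum_(u in U) f u * g u.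

Definition swap_form f g : R :=
  \sum_(j < n) \sum_(k < n) \sum_(u in U)
     (f u - shift (tperm j k) f u) * (g u - shift (tperm j k) g u).

Lemma dot_invariant : invariant_form dot.
Proof.
split.
- by move=> f g h e; apply: eq_bigr => u _; rewrite e.
- by move=> f g; apply: eq_bigr => u _; rewrite mulrC.
- by move=> f g h; rewrite -sumrB; apply: eq_bigr => u _; rewrite mulrBl.
- move=> A c F h; rewrite /dot.
  rewrite exchange_big mulr_sumr /=; apply: eq_bigr => u _.
  by rewrite -mulrA mulr_suml.
- by move=> s f g; rewrite /dot /shift (sum_act _ (fun u => f u * g u)).
Qed.

Lemma swap_form_invariant : invariant_form swap_form.
Proof.
split.
- move=> f g h e; do 3!(apply: eq_bigr => ? _); by rewrite /shift !e.
- move=> f g; do 3!(apply: eq_bigr => ? _); by rewrite mulrC.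
- move=> f g h; rewrite -sumrB; apply: eq_bigr => j _.
  rewrite -sumrB; apply: eq_bigr => k _; rewrite -sumrB; apply: eq_bigr => u _.
  by rewrite /shift; ring.
- move=> A c F h; rewrite /swap_form mulr_sumr.
  under [RHS]eq_bigr => s _ do rewrite mulr_sumr.
  rewrite [RHS]exchange_big; apply: eq_bigr => j _ /=.
  under [RHS]eq_bigr => s _ do rewrite mulr_sumr.
  rewrite [RHS]exchange_big; apply: eq_bigr => k _ /=.
  under [RHS]eq_bigr => s _ do rewrite mulr_sumr.
  rewrite [RHS]exchange_big; apply: eq_bigr => u _ /=.
  by rewrite /shift -mulr_sumr -mulr_suml sumrB -mulrBr mulrA.
(* Conjugation by [s] permutes the transpositions. *)
- move=> s f g; rewrite /swap_form.
  rewrite [RHS](reindex_inj (@perm_inj _ s^-1%g)) /=; apply: eq_bigr => j _.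
  rewrite [RHS](reindex_inj (@perm_inj _ s^-1%g)) /=; apply: eq_bigr => k _.
  rewrite -[RHS](sum_act _ _ s); apply: eq_bigr => u _.
  by rewrite /shift act_tpermC.
Qed.

Lemma swap_formE f : swap_form f f = energy kappa f.
Proof. by do 3!(apply: eq_bigr => ? _); rewrite expr2. Qed.

(** Each [t] in [Sym S] factors uniquely as [tperm i j * s] with [s] fixing [i]; here [j] is the
    preimage of [i] under [t]. *)
Lemma sum_Sym_cosets (V : nmodType) S i (F : 'S_n -> V) : i \in S ->
  \sum_(t in Sym S) F t = \sum_(j in S) \sum_(s in Sym (S :\ i)) F (tperm i j * s)%g.
Proof.
move=> iS; rewrite (partition_big (fun t : 'S_n => t^-1%g i) [in S]) /= => [|t]; last first.
  by rewrite -groupV inE => /perm_closed ->.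
apply: eq_bigr => j jS; rewrite (reindex_inj (mulgI (tperm i j))) /=.
have tS : tperm i j \in Sym S.
  rewrite inE; apply: subset_trans (tperm_on i j) _.
  by apply/subsetP => k; rewrite !inE => /orP[] /eqP ->.
apply: eq_bigl => s; rewrite groupMl //.
have -> : ((tperm i j * s)^-1%g i == j) = (s i == i).
  rewrite invMg permM tpermV (canF_eq (tpermK i j)) tpermR.
  by rewrite (canF_eq (permKV s)) eq_sym.
rewrite !inE; apply/andP/idP => [[sS /eqP si]|sS].
  apply/subsetP => k sk; rewrite in_setD1 (subsetP sS) // andbT.
  by apply: contraNneq sk => ->; rewrite si.
split; first by apply: subset_trans sS _; exact: subD1set.
by rewrite (out_perm sS) // !inE eqxx.
Qed.

Lemma averageD1 S i f u : i \in S ->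
  average S f u
    = #|S|%:R^-1 * \sum_(j in S) average (S :\ i) (shift (tperm i j) f) u.
Proof.
move=> iS; rewrite /average (sum_Sym_cosets _ iS) -mulr_sumr mulrA.
congr (_ * _).
  rewrite !card_Sym (cardsD1 i S) iS add1n factS natrM invfM mulrC.
  by rewrite mulrC.
apply: eq_bigr => j _; apply: eq_bigr => s _.
by rewrite /shift coloring_actM.
Qed.

Lemma l1_average S f :
  \sum_(u in U) `|average S f u| <= \sum_(u in U) `|f u|.
Proof.
apply: le_trans (_ : \sum_(u in U) #|Sym S|%:R^-1 * \sum_(s in Sym S) `|shift s f u| <= _).
  apply: ler_sum => u _; rewrite normrM ger0_norm ?invr_ge0 //.
  by rewrite ler_wpM2l ?invr_ge0 // ler_norm_sum.
rewrite -mulr_sumr exchange_big /=.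
rewrite (eq_bigr (fun=> \sum_(u in U) `|f u|)) => [|s _].
  rewrite sumr_const -[X in _ * X]mulr_natl mulrA mulVf ?mul1r // pnatr_eq0 -lt0n.
  exact: cardG_gt0.
exact: (sum_act _ (fun u => `|f u|)).
Qed.

Definition l1_swap f (j k : 'I_n) : R := \sum_(u in U) `|f u - shift (tperm j k) f u|.

(** By [averageD1] the difference is a mean over [j] of averages of [f - shift (tperm i j) f], and
    averaging contracts the l1 norm. *)
Lemma l1_average_sub S i f : i \in S ->
  \sum_(u in U) `|average (S :\ i) f u - average S f u|
    <= #|S|%:R^-1 * \sum_(j in S) l1_swap f i j.
Proof.
move=> iS.
have S0 : #|S|%:R != 0 :> R by rewrite pnatr_eq0 -lt0n card_gt0; apply/set0Pn; exists i.
apply: le_trans (_ : \sum_(u in U) #|S|%:R^-1 * \sum_(j in S)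
    `|average (S :\ i) (fun v => f v - shift (tperm i j) f v) u| <= _).
  apply: ler_sum => u _; rewrite (averageD1 _ _ iS).
  have -> : average (S :\ i) f u = #|S|%:R^-1 * \sum_(j in S) average (S :\ i) f u.
    by rewrite sumr_const -[X in _ * X]mulr_natl mulrA mulVf ?mul1r.
  rewrite -mulrBr -sumrB normrM ger0_norm ?invr_ge0 // ler_wpM2l ?invr_ge0 //.
  apply: le_trans (ler_norm_sum _ _ _) _; apply: ler_sum => j _.
  by rewrite /average -mulrBr -sumrB.
rewrite -mulr_sumr ler_wpM2l ?invr_ge0 // exchange_big /=.
by apply: ler_sum => j _; exact: l1_average.
Qed.

Lemma multislice_transitive u v : u \in U -> v \in U -> exists s, act u s = v.
Proof.
move=> uU vU.
have /tuple_permP[s hs] : perm_eq [tuple v j | j < n] [tuple u j | j < n].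
  have count_color (w : X) c : w \in U -> count_mem c [tuple w j | j < n] = kappa c.
    move=> /multisliceP <-; rewrite -sum1_count big_tuple -sum1dep_card.
    by apply: eq_bigl => j; rewrite tnth_mktuple.
  by apply/allP => c _ /=; rewrite !count_color.
exists s; apply/ffunP => j; rewrite ffunE.
have := congr1 (fun r : seq 'I_l => nth (v j) r j) hs.
by rewrite -!tnth_nth !tnth_mktuple => ->.
Qed.

(* The average over all of [Sym setT] is constant on the multislice. *)
Lemma dot_averageT f :
  dot (average setT f) (average setT f) = (\sum_(u in U) f u) ^+ 2 / #|U|%:R.
Proof.
have [U0|/set0Pn[u0 u0U]] := eqVneq U set0.
  by rewrite /dot U0 !big_set0 expr0n mul0r.
have N0 : #|U|%:R != 0 :> R by rewrite pnatr_eq0 -lt0n card_gt0; apply/set0Pn; exists u0.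
have avgc u : u \in U -> average setT f u = average setT f u0.
  move=> uU; have [s <-] := multislice_transitive u0U uU.
  apply: (shift_average f (s := s)).
  by rewrite inE; apply/subsetP => j _; rewrite inE.
have sumavg : \sum_(u in U) average setT f u = \sum_(u in U) f u.
  rewrite -mulr_sumr exchange_big /=.
  rewrite (eq_bigr (fun=> \sum_(u in U) f u)) => [|s _]; last exact: sum_act.
  rewrite sumr_const -[X in _ * X]mulr_natl mulrA mulVf ?mul1r // pnatr_eq0 -lt0n.
  exact: cardG_gt0.
rewrite -sumavg /dot (eq_bigr (fun=> average setT f u0 ^+ 2)) => [|u uU]; last first.
  by rewrite avgc.
rewrite (eq_bigr _ avgc) !sumr_const -[_ ^+ 2 *+ _]mulr_natr -[_ u0 *+ _]mulr_natr.
by field.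
Qed.

End Averaging.

(** * Influences *)

(** The symmetric group is 2-transitive, so a uniform permutation sends [(i, j)] to a uniform
    ordered pair of distinct points. *)
Lemma sum_perm_pair (R : realType) (n : nat) (J : 'I_n -> 'I_n -> R) i j :
  (forall a, J a a = 0) -> i != j ->
  (n%:R * (n%:R - 1)) * \sum_(s : 'S_n) J (s i) (s j) = n`!%:R * \sum_a \sum_b J a b.
Proof.
move=> J0 ij.
have K a b : a != b -> \sum_(s : 'S_n) J (s a) (s b) = \sum_(s : 'S_n) J (s i) (s j).
  move=> ab; pose t := (tperm i a * tperm (tperm i a j) b)%g.
  have ti : t i = a.
    rewrite permM tpermL tpermD //; last by rewrite eq_sym.
    by rewrite -{2}(tpermL i a) (inj_eq perm_inj) eq_sym.
  have tj : t j = b by rewrite permM tpermL.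
  rewrite [RHS](reindex_inj (mulgI t)) /=; apply: eq_bigr => s _.
  by rewrite (permM t s i) (permM t s j) ti tj.
have e : \sum_a \sum_(b | b != a) \sum_(s : 'S_n) J (s a) (s b)
   = n`!%:R * \sum_a \sum_b J a b.
  transitivity (\sum_a \sum_b \sum_(s : 'S_n) J (s a) (s b)).
    apply: eq_bigr => a _; rewrite [RHS](bigD1 a) //=.
    by rewrite (_ : \sum_(s : 'S_n) J (s a) (s a) = 0) ?add0r // big1.
  under eq_bigr => a _ do rewrite exchange_big.
  rewrite exchange_big (eq_bigr (fun=> \sum_a \sum_b J a b)) => [|s _].
    by rewrite sumr_const cardT -cardE card_Sn mulr_natl.
  rewrite [RHS](reindex_inj (@perm_inj _ s)) /=; apply: eq_bigr => a _.
  by rewrite [RHS](reindex_inj (@perm_inj _ s)).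
rewrite -e [RHS](eq_bigr (fun=> (n%:R - 1) * \sum_(s : 'S_n) J (s i) (s j))) => [|a _].
  by rewrite sumr_const card_ord -[RHS]mulr_natl mulrA.
rewrite (eq_bigr (fun=> \sum_(s : 'S_n) J (s i) (s j))) => [|b ba]; last first.
  by rewrite K // eq_sym.
have -> : n%:R - 1 = (#|predC1 a|)%:R :> R.
  by rewrite cardC1 card_ord -subn1 natrB //; case: n a {ij J J0 K e i j} => // -[].
by rewrite sumr_const mulr_natl.
Qed.

Section KKL.
Variables (R : realType) (l n : nat) (kappa : histogram l).
Hypothesis l2 : (2 <= l)%N.
Local Notation U := (multislice n kappa).
Hypothesis U0 : (0 < #|U|)%N.
Hypothesis n2 : (2 <= n)%N.
Implicit Types (f : coloring l n -> R).

(** The coordinates still hidden after [i] steps: [average (tail i) f] is the martingale of [f] when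
    they are revealed in increasing order. *)
Let tail (i : nat) : {set 'I_n} := [set j : 'I_n | (i <= j)%N].

Let tailS (i : 'I_n) : tail i :\ i = tail i.+1.
Proof. by apply/setP => j; rewrite !inE ltn_neqAle eq_sym. Qed.

Let tail0 : tail 0 = setT.
Proof. by apply/setP => j; rewrite !inE. Qed.

Let tailn : tail n = set0.
Proof. by apply/setP => j; rewrite !inE leqNgt ltn_ord. Qed.

(** Pythagoras for consecutive averages, telescoped from [average setT f] to [f]. *)
Lemma sum_average_tail (B : (coloring l n -> R) -> (coloring l n -> R) -> R) f :
  invariant_form B ->
  \sum_(i < n) (let d u := average (tail i.+1) f u - average (tail i) f u in B d d)
    = B f f - B (average setT f) (average setT f).
Proof.
move=> HB.
pose Q i := B (average (tail i) f) (average (tail i) f).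
have -> : B f f = Q n.
  rewrite /Q tailn (form_eq HB (g := f)); last exact: average0.
  rewrite [RHS](form_sym HB) (form_eq HB (g := f)) //; exact: average0.
rewrite -tail0 -/(Q 0%N) -(telescope_sumr Q (leq0n n)) big_mkord.
apply: eq_bigr => i _; apply: (form_average_sub HB).
apply/subsetP => s; rewrite !inE => sS; apply: subset_trans sS _.
by rewrite -tailS subD1set.
Qed.

(** The log-Sobolev inequality is applied to each [d i], with [ent_sqr_ge] at a common [s]. The
    squared norms of the [d i] add up to the variance term, and their energies to at most that of
    [f]. *)
Lemma kkl_ordered f (s : R) : 0 < s ->
  (\sum_(u in U) f u ^+ 2 - (\sum_(u in U) f u) ^+ 2 / #|U|%:R) * (ln s + 1)
   - s / #|U|%:R * \sum_(i < n) (#|tail i|%:R^-1 * \sum_(j in tail i) l1_swap kappa f i j) ^+ 2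
  <= log_sobolev_const R n kappa * energy kappa f.
Proof.
move=> s0; pose d (i : 'I_n) u := average (tail i.+1) f u - average (tail i) f u.
have lc0 : 0 <= log_sobolev_const R n kappa.
  have := U0; rewrite card_gt0 => /set0Pn[u uU].
  apply: divr_ge0; last by rewrite subr_ge0 ler1n ltnW.
  apply: sumr_ge0 => c _.
  have n0 : (0 < n)%N by exact: ltnW.
  have : ln (kappa c).+1%:R <= ln (2 * n%:R) :> R.
    rewrite ler_ln ?posrE ?mulr_gt0 ?ltr0n // -natrM ler_nat.
    by have := hist_le c uU; lia.
  rewrite lnM ?posrE ?ltr0n //.
  by have := @ln_le_sub1 R 2; lra.
have E : \sum_(i < n) energy kappa (d i) <= energy kappa f.
  have := sum_average_tail f (@swap_form_invariant R l n kappa).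
  rewrite /= -!swap_formE => ->; rewrite gerBl swap_formE.
  by do 3!(apply: sumr_ge0 => ? _); exact: sqr_ge0.
apply: le_trans (_ : log_sobolev_const R n kappa * \sum_(i < n) energy kappa (d i) <= _); last first.
  exact: ler_wpM2l.
have -> : \sum_(u in U) f u ^+ 2 - (\sum_(u in U) f u) ^+ 2 / #|U|%:R
   = \sum_(i < n) \sum_(u in U) d i u ^+ 2.
  have := sum_average_tail f (@dot_invariant R l n kappa).
  rewrite dot_averageT /= /dot => h.
  under eq_bigr => u _ do rewrite expr2.
  rewrite -h; apply: eq_bigr => i _; apply: eq_bigr => u _; exact: expr2.
rewrite mulr_suml mulr_sumr [leRHS]mulr_sumr -sumrB; apply: ler_sum => i _.
apply: le_trans (log_sobolev_multislice kappa (d i) l2).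
apply: le_trans (ent_sqr_ge (d i) U0 s0); rewrite lerD2l lerN2 mulrAC.
rewrite ler_wpM2l ?divr_ge0 ?(ltW s0) // lerXn2r ?nnegrE ?sumr_ge0 //.
  by rewrite mulr_ge0 ?invr_ge0 // sumr_ge0 // => j _; rewrite sumr_ge0.
rewrite /d -tailS; apply: l1_average_sub.
by rewrite inE.
Qed.

Lemma l1_swap_shift f (s : 'S_n) j k :
  l1_swap kappa (shift s f) j k = l1_swap kappa f (s^-1%g j) (s^-1%g k).
Proof.
rewrite /l1_swap -[RHS](sum_act _ _ s); apply: eq_bigr => u _.
by rewrite /shift act_tpermC.
Qed.

(** The coordinates are revealed in the order [p], which changes neither the moments nor the energy
    of [f]. In each squared l1 bound one factor becomes [b]; the other stays, to be averaged over
    [p]. *)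
Lemma kkl_ordered_shift f (s : R) (b : R) (p : 'S_n) : 0 < s ->
  (forall j k, l1_swap kappa f j k <= b) ->
  (\sum_(u in U) f u ^+ 2 - (\sum_(u in U) f u) ^+ 2 / #|U|%:R) * (ln s + 1)
   - s * b / #|U|%:R * \sum_(i < n) (#|tail i|%:R^-1 *
        \sum_(j in tail i) l1_swap kappa f (p i) (p j))
  <= log_sobolev_const R n kappa * energy kappa f.
Proof.
move=> s0 hb.
have := kkl_ordered (shift p^-1%g f) s0.
rewrite -!swap_formE (form_shift (@swap_form_invariant R l n kappa)) swap_formE.
rewrite (sum_act _ (fun u => f u ^+ 2)) (sum_act _ f).
apply: le_trans; rewrite lerD2l lerN2.
rewrite [s * b / _]mulrAC -[s / _ * b * _]mulrA ler_wpM2l ?divr_ge0 ?(ltW s0) //.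
rewrite mulr_sumr; apply: ler_sum => i _.
under eq_bigr => j _ do rewrite l1_swap_shift invgK.
set a := _ * _; rewrite expr2.
have t0 : (0 < #|tail i|)%N by rewrite card_gt0; apply/set0Pn; exists i; rewrite inE.
have a0 : 0 <= a.
  by rewrite mulr_ge0 ?invr_ge0 // sumr_ge0 // => j _; rewrite sumr_ge0.
rewrite ler_wpM2r // /a mulrC ler_pdivrMr ?ltr0n // mulr_natr -sumr_const.
exact: ler_sum.
Qed.

(** Averaged over [p], each [l1_swap kappa f (p i) (p j)] with [i != j] becomes the mean over
    ordered pairs, so each of the [n] steps contributes at most [T / (n (n - 1))]. *)
Theorem kkl f (s : R) (b : R) : 0 < s ->
  (forall j k, l1_swap kappa f j k <= b) ->
  (\sum_(u in U) f u ^+ 2 - (\sum_(u in U) f u) ^+ 2 / #|U|%:R) * (ln s + 1)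
   - s * b / #|U|%:R * ((\sum_j \sum_k l1_swap kappa f j k) / (n%:R - 1))
  <= log_sobolev_const R n kappa * energy kappa f.
Proof.
move=> s0 hb; set T := \sum_j \sum_k _; set V := _ * (ln s + 1).
have n0 : 0 < n%:R :> R by rewrite ltr0n ltnW.
have n1 : 0 < n%:R - 1 :> R by rewrite subr_gt0 ltr1n.
have J0 a : l1_swap kappa f a a = 0.
  by rewrite /l1_swap big1 // => u _; rewrite /shift tperm1 coloring_act1 subrr normr0.
have b0 : 0 <= b.
  by rewrite -(J0 (Ordinal (ltnW n2))).
have T0 : 0 <= T by do 3!(apply: sumr_ge0 => ? _).
have f0 : 0 < n`!%:R :> R by rewrite ltr0n fact_gt0.
have : \sum_(p : 'S_n) (V - s * b / #|U|%:R * \sum_(i < n) (#|tail i|%:R^-1 *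
        \sum_(j in tail i) l1_swap kappa f (p i) (p j)))
   <= \sum_(p : 'S_n) log_sobolev_const R n kappa * energy kappa f.
  by apply: ler_sum => p _; exact: kkl_ordered_shift.
rewrite sumrB !sumr_const -mulr_sumr cardT -cardE card_Sn -[V *+ _]mulr_natl.
rewrite -[_ * energy _ _ *+ _]mulr_natl => h.
rewrite -(ler_pM2l f0); apply: le_trans h; rewrite mulrBr lerD2l lerN2.
rewrite mulrCA ler_wpM2l ?divr_ge0 ?mulr_ge0 ?(ltW s0) //.
rewrite exchange_big /=.
have -> : n`!%:R * (T / (n%:R - 1)) = \sum_(i < n) n`!%:R * T / (n%:R * (n%:R - 1)).
  rewrite sumr_const card_ord -[RHS]mulr_natl; field.
  by rewrite !gt_eqF.
apply: ler_sum => i _; rewrite -mulr_sumr exchange_big /=.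
have t0 : (0 < #|tail i|)%N by rewrite card_gt0; apply/set0Pn; exists i; rewrite inE.
rewrite mulrC ler_pdivrMr ?ltr0n // mulr_natr -sumr_const; apply: ler_sum => j _.
have [<-|ij] := eqVneq i j.
  by rewrite big1 // divr_ge0 ?mulr_ge0 // ltW.
rewrite ler_pdivlMr ?mulr_gt0 // mulrC.
by rewrite (sum_perm_pair J0 ij).
Qed.

End KKL.

(** * Shadows *)

Section Shadow.
Variables (R : realType) (l n : nat) (kappa : histogram l).
Local Notation X := (coloring l n).
Local Notation U := (multislice n kappa).
Implicit Types (u w : X) (a b c : 'I_l).

Definition update w j c : X := [ffun k => if k == j then c else w k].

Lemma update_at w j c : update w j c j = c.
Proof. by rewrite ffunE eqxx. Qed.

Lemma updateK w j c d : w j = d -> update (update w j c) j d = w.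
Proof. by move=> wj; apply/ffunP => k; rewrite !ffunE; case: eqVneq => // ->. Qed.

Lemma update_tperm u j k a b :
  j != k -> u j = a -> u k = b -> update (update u j b) k a = act u (tperm j k).
Proof.
move=> jk uj uk; apply/ffunP => i; rewrite !ffunE.
case: tpermP => [->|->|/eqP ij /eqP ik]; first by rewrite (negbTE jk) eqxx.
  by rewrite eqxx.
by rewrite (negbTE ij) (negbTE ik).
Qed.

Lemma update_multislice w j a b : a != b -> (0 < kappa a)%N -> w j = b ->
  (update w j a \in U) = (w \in multislice n (recolor kappa a b)).
Proof.
move=> ab ka wj; rewrite !inE; apply: eq_forallb => c; rewrite ffunE.
have cnt (v : X) : #|[set i | v i == c]| = ((v j == c) + \sum_(i | i != j) (v i == c))%N.
  rewrite -sum1dep_card big_mkcond (bigD1 j) //=; congr (_ + _)%N.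
rewrite !cnt update_at wj (eq_bigr (fun i => nat_of_bool (w i == c))) => [|i ij]; last first.
  by rewrite ffunE (negbTE ij).
set r := (\sum_(i | _) _)%N; have [->|cb] := eqVneq c b.
  by rewrite (negbTE ab); apply/eqP/eqP; lia.
have [->|ca] := eqVneq c a.
  by apply/eqP/eqP; lia.
by [].
Qed.

(** Both sides run over the edges of the bipartite graph between the two multislices, an edge being
    a point with the coordinate to recolor. *)
Lemma sum_update (V : nmodType) a b (F : X -> 'I_n -> V) : a != b -> (0 < kappa a)%N ->
  \sum_(w in multislice n (recolor kappa a b)) \sum_(j | w j == b) F (update w j a) j
    = \sum_(u in U) \sum_(j | u j == a) F u j.
Proof.
move=> ab ka; rewrite !pair_big_dep /=.
pose h c (x : X * 'I_n) := (update x.1 x.2 c, x.2).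
rewrite [RHS](reindex_onto (h a) (h b)) => [|[u j] /= /andP[_ /eqP uj]]; last first.
  by rewrite /h /= updateK.
apply: eq_bigl => -[w j] /=; rewrite update_at eqxx andbT.
have -> : (h b (h a (w, j)) == (w, j)) = (w j == b).
  apply/eqP/eqP => [[/(congr1 (fun v : X => v j))]|wj]; first by rewrite update_at.
  by rewrite /h /= updateK.
have [wj|] := eqVneq (w j) b; last by rewrite !andbF.
by rewrite (update_multislice ab ka wj).
Qed.

Variable A : {set X}.

Definition boundary a b : R :=
  \sum_(u in A) \sum_(j | u j == a) \sum_(k | u k == b) (act u (tperm j k) \notin A)%:R.

Lemma boundaryC a b : boundary a b = boundary b a.
Proof.
apply: eq_bigr => u _; rewrite exchange_big /=; apply: eq_bigr => j _.
by apply: eq_bigr => k _; rewrite tpermC.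
Qed.

Hypothesis AU : A \subset U.

(** [D] may be any set containing the points with a neighbor in [A], which covers both kinds of
    shadow. The factor [kappa a * kappa b] is the number of ordered pairs of coordinates colored
    [a], [b], as needed for the expectation. *)
Lemma shadow_gain a b (D : {set X}) :
  a != b -> (0 < kappa a)%N -> (0 < kappa b)%N -> (0 < #|U|)%N ->
  (forall w j, w \in multislice n (recolor kappa a b) -> w j = b ->
     update w j a \in A -> w \in D) ->
  D \subset multislice n (recolor kappa a b) ->
  (kappa a)%:R * (kappa b)%:R * vol R kappa A + boundary a b / (2 * #|U|%:R)
    <= (kappa a)%:R * (kappa b)%:R * vol R (recolor kappa a b) D.
Proof.
move=> ab ka kb N0 hD Dsub; rewrite /vol.
set U' := multislice n (recolor kappa a b) in hD Dsub *.
have AinU (F : X -> R) : \sum_(u in U) (u \in A)%:R * F u = \sum_(u in A) F u.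
  rewrite big_mkcond [RHS]big_mkcond; apply: eq_bigr => u _.
  have [uA|_] := boolP (u \in A); last by rewrite mul0r if_same.
  by rewrite (subsetP AU) // mul1r.
pose K : R := (kappa b).+1%:R; have KE : K = (kappa b)%:R + 1 by rewrite natr1.
have K0 : 0 < K by rewrite ltr0n.
have cK w : w \in U' -> \sum_(j | w j == b) 1 = K.
  by move=> wU; rewrite (sum_color _ _ wU) mulr1 ffunE eqxx.
clearbody K.
pose e w : R := \sum_(j | w j == b) (update w j a \in A)%:R.
have e0 w : 0 <= e w by apply: sumr_ge0.
have NK : #|U'|%:R * K = #|U|%:R * (kappa a)%:R.
  have := sum_update (fun _ _ => 1 : R) ab ka; rewrite -/U'.
  rewrite (eq_bigr _ cK) sumr_const -[_ *+ _]mulr_natl => ->.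
  rewrite (eq_bigr (fun=> (kappa a)%:R)) => [|u uU]; last by rewrite (sum_color _ _ uU) mulr1.
  by rewrite sumr_const -[_ *+ #|_|]mulr_natl.
have sum_e : \sum_(w in U') e w = (kappa a)%:R * #|A|%:R.
  rewrite (sum_update (fun u _ => (u \in A)%:R) ab ka).
  rewrite (eq_bigr (fun u => (u \in A)%:R * (kappa a)%:R)) => [|u uU].
    by rewrite AinU sumr_const mulr_natr.
  by rewrite (sum_color _ _ uU) mulrC.
(* This counts pairs of neighbors of [w] with the first in [A] and the second outside; seen from the
   first, the second is obtained by swapping two coordinates. *)
have sum_ee : \sum_(w in U') e w * (K - e w) = boundary a b.
  pose F u j : R := (u \in A)%:R * \sum_(k | update u j b k == b)
     (update (update u j b) k a \notin A)%:R.
  transitivity (\sum_(w in U') \sum_(j | w j == b) F (update w j a) j).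
    apply: eq_bigr => w wU; rewrite mulr_suml; apply: eq_bigr => j /eqP wj.
    rewrite /F updateK // -(cK w wU) -sumrB; congr (_ * _); apply: eq_bigr => k _.
    by case: (_ \in A); rewrite ?subrr ?subr0.
  rewrite sum_update // /boundary -AinU; apply: eq_bigr => u _; rewrite mulr_sumr.
  apply: eq_bigr => j /eqP uj; rewrite /F.
  have [uA|_] := boolP (u \in A); last by rewrite !mul0r.
  congr (_ * _); rewrite (bigD1 j) ?update_at //= updateK // uA add0r.
  apply: eq_big => [k|k /andP[+ kj]].
    rewrite ffunE; have [->|_] := eqVneq k j; last by rewrite andbT.
    by rewrite andbF uj (negbTE ab).
  rewrite ffunE (negbTE kj) => /eqP uk.
  by rewrite (update_tperm _ uj uk) // eq_sym.
(* With [t = e w / K] the slack for [t > 0] is [1 - t - t (1 - t) = (1 - t) ^+ 2]. *)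
have De w : w \in U' -> e w / K + e w * (K - e w) / K ^+ 2 <= (w \in D)%:R.
  move=> wU; have [ez|en0] := eqVneq (e w) 0; first by rewrite ez !mul0r addr0.
  have [j /andP[/eqP wj wA]] : exists j, (w j == b) && (update w j a \in A).
    apply/existsP; apply: contraNT en0 => /existsPn h; apply/eqP/big1 => j wj.
    by have := h j; rewrite wj /= => /negbTE ->.
  rewrite (hD w j) // -subr_ge0.
  have -> : 1 - (e w / K + e w * (K - e w) / K ^+ 2) = (1 - e w / K) ^+ 2.
    by field; rewrite gt_eqF.
  exact: sqr_ge0.
have Dge : (kappa a)%:R * #|A|%:R / K + boundary a b / K ^+ 2 <= #|D|%:R.
  rewrite -sum_e -sum_ee !mulr_suml -big_split /=.
  apply: le_trans (ler_sum _ De) _.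
  rewrite -sum1_card natr_sum big_mkcond [leRHS]big_mkcond; apply: ler_sum => w _.
  have [wD|_] := boolP (w \in D); last by rewrite if_same.
  by rewrite (subsetP Dsub _ wD).
have Q0 : 0 <= boundary a b by do 3!(apply: sumr_ge0 => ? _).
have N0R : 0 < #|U|%:R :> R by rewrite ltr0n.
have kaR : 0 < (kappa a)%:R :> R by rewrite ltr0n.
have kbR : 1 <= (kappa b)%:R :> R by rewrite ler1n.
have N'E : #|U'|%:R = #|U|%:R * (kappa a)%:R / K by rewrite -NK mulfK // gt_eqF.
rewrite N'E.
apply: le_trans (_ : (kappa b)%:R * K / #|U|%:R *
   ((kappa a)%:R * #|A|%:R / K + boundary a b / K ^+ 2) <= _); last first.
  rewrite [leRHS](_ : _ = (kappa b)%:R * K / #|U|%:R * #|D|%:R).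
    by rewrite ler_wpM2l // divr_ge0 ?mulr_ge0 // ltW.
  by field; rewrite !gt_eqF.
have -> : (kappa b)%:R * K / #|U|%:R * ((kappa a)%:R * #|A|%:R / K + boundary a b / K ^+ 2)
  = (kappa a)%:R * (kappa b)%:R * (#|A|%:R / #|U|%:R)
    + (kappa b)%:R / K * (boundary a b / #|U|%:R).
  by field; rewrite !gt_eqF.
(* The factor 1/2 comes from [kappa b / (kappa b + 1) >= 1 / 2]. *)
rewrite lerD2l invfM mulrCA ler_wpM2r ?divr_ge0 ?(ltW N0R) //.
by rewrite ler_pdivlMr // KE; lra.
Qed.

End Shadow.

Section Expectation.
Variables (R : realType) (l n : nat) (kappa : histogram l).
Local Notation X := (coloring l n).
Local Notation U := (multislice n kappa).
Variable A : {set X}.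
Hypothesis AU : A \subset U.

(** Twice the number [J] of the outline, as [j] and [k] are ordered; the diagonal vanishes. *)
Definition total_boundary : R :=
  \sum_(u in A) \sum_j \sum_k (act u (tperm j k) \notin A)%:R.

Lemma boundary_diag a : boundary R A a a = 0.
Proof.
rewrite /boundary big1 // => u uA; rewrite big1 // => j /eqP uj.
by rewrite big1 // => k /eqP uk; rewrite act_tperm_id ?uj ?uk // uA.
Qed.

Lemma sum_boundary : \sum_a \sum_b boundary R A a b = total_boundary.
Proof.
under eq_bigr => a _ do rewrite exchange_big.
rewrite exchange_big; apply: eq_bigr => u _ /=.
rewrite [RHS](partition_big (fun j => u j) predT) //=; apply: eq_bigr => a _.
rewrite exchange_big; apply: eq_bigr => j _ /=.
by rewrite [RHS](partition_big (fun k => u k) predT).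
Qed.

(** The colors [a], [b] occur at [kappa a * kappa b] pairs of coordinates, so the hypotheses sum
    over [a != b]; the normalisation [Z] is at most [n ^+ 2]. *)
Lemma expect_colors_ge (u : X) (g : 'I_l -> 'I_l -> R) (x : R) :
  u \in U -> bichromatic u != set0 ->
  (forall a b, a != b ->
    (kappa a)%:R * (kappa b)%:R * x + boundary R A a b / (2 * #|U|%:R)
      <= (kappa a)%:R * (kappa b)%:R * (if (a < b)%N then g a b else g b a)) ->
  x + total_boundary / (2 * #|U|%:R * n%:R ^+ 2) <= expect_colors u g.
Proof.
move=> uU bi hg; rewrite /expect_colors.
set Z : R := #|bichromatic u|%:R.
have Z0 : 0 < Z by rewrite ltr0n card_gt0.
have N0 : 0 < #|U|%:R :> R by rewrite ltr0n card_gt0; apply/set0Pn; exists u.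
have T0 : 0 <= total_boundary by do 3!(apply: sumr_ge0 => ? _).
have Zn : Z <= n%:R ^+ 2.
  rewrite -natrX ler_nat; apply: leq_trans (max_card _) _.
  by rewrite card_prod card_ord mulnn.
have ZE : Z = \sum_(a < l) \sum_(b < l | b != a) (kappa a)%:R * (kappa b)%:R.
  rewrite /Z -sum1_card natr_sum (sum_bichromatic (fun _ _ => 1) uU).
  apply: eq_bigr => a _; rewrite -[(\sum_(b < l) _) *+ _]mulr_natl mulr_sumr [RHS]big_mkcond.
  apply: eq_bigr => b _; rewrite eq_sym; case: ifP => _; last by rewrite mul0rn mulr0.
  by [].
rewrite (sum_bichromatic (fun a b => if (a < b)%N then g a b else g b a) uU).
rewrite ler_pdivlMr // mulrDl.
apply: le_trans (_ : x * Z + total_boundary / (2 * #|U|%:R) <= _).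
  rewrite lerD2l invfM mulrA -[leLHS]mulrA ler_piMr //.
    by rewrite divr_ge0 ?mulr_ge0 // ltW.
  by rewrite mulrC ler_pdivrMr ?mul1r // (lt_le_trans Z0).
have -> : total_boundary = \sum_a \sum_(b | b != a) boundary R A a b.
  rewrite -sum_boundary; apply: eq_bigr => a _.
  by rewrite (bigD1 a) //= boundary_diag add0r.
rewrite ZE mulr_sumr mulr_suml -big_split /=; apply: ler_sum => a _.
rewrite mulr_sumr mulr_suml -big_split /= -[(\sum_(b < l) _) *+ _]mulr_natl mulr_sumr big_mkcond.
apply: ler_sum => b _; rewrite eq_sym; have [_|ab] := eqVneq a b.
  by rewrite mul0rn mulr0.
have := hg a b ab; set y := (if _ then _ else _); rewrite -[y *+ _]mulr_natr.
by congr (_ <= _); ring.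
Qed.

End Expectation.

Section Shadows.
Variables (R : realType) (l n : nat) (kappa : histogram l) (A : {set coloring l n}).
Local Notation U := (multislice n kappa).
Hypotheses (l2 : (2 <= l)%N) (kappa_gt0 : forall c, (0 < kappa c)%N).
Hypotheses (AU : A \subset U) (U0 : U != set0).

Lemma bichromatic_neq0 (u : coloring l n) : u \in U -> bichromatic u != set0.
Proof.
move=> uU.
have hit c : exists j, u j = c.
  have := kappa_gt0 c; rewrite -(multisliceP _ _ uU c) card_gt0 => /set0Pn[j].
  by rewrite inE => /eqP; exists j.
have [j uj] := hit (Ordinal (ltnW l2)); have [k uk] := hit (Ordinal l2).
by apply/set0Pn; exists (j, k); rewrite inE /= uj uk.
Qed.

Lemma prec_update (w : coloring l n) j (a : 'I_l) :
  (w j < a)%N -> prec w (update w j a).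
Proof.
move=> lt; apply/andP; split; last first.
  by apply/forallP => k; rewrite ffunE; case: eqVneq => // ->; rewrite ltnW.
by apply/eqP => /(congr1 (fun v : coloring l n => v j)) e; move: lt; rewrite e update_at ltnn.
Qed.

Lemma update_prec (w : coloring l n) j (a : 'I_l) :
  (a < w j)%N -> prec (update w j a) w.
Proof.
move=> lt; rewrite -{2}(updateK a (erefl (w j))).
by apply: prec_update; rewrite update_at.
Qed.

(** For [c < d], raising a coordinate from [c] to [d] leads from the lower neighbor up into [U], so
    [shadow_gain] applies to the lower shadow. The symmetry of [boundary] treats the other order of
    the colors. *)
Lemma expect_lower_ge :
  vol R kappa A + total_boundary R A / (2 * #|U|%:R * n%:R ^+ 2)
    <= expect_lower n kappa (fun kappa' => vol R kappa' (lower_shadow kappa' A)).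
Proof.
have [u uU] := set0Pn _ U0; rewrite (expect_lowerE _ uU).
apply: expect_colors_ge => // [|a b ab]; first exact: bichromatic_neq0.
have N0 : (0 < #|U|)%N by rewrite card_gt0.
have gain (c d : 'I_l) : (c < d)%N ->
  (kappa d)%:R * (kappa c)%:R * vol R kappa A + boundary R A d c / (2 * #|U|%:R)
  <= (kappa d)%:R * (kappa c)%:R
     * vol R (recolor kappa d c) (lower_shadow (recolor kappa d c) A).
  move=> cd; apply: shadow_gain => //.
  - by rewrite neq_ltn; apply/orP; right.
  - move=> w j wU wj wA; rewrite in_set wU; apply/existsP; exists (update w j d).
    by rewrite wA prec_update // wj.
  - by apply/subsetP => w; rewrite in_set => /andP[].
have [lt|ge] := ltnP a b.
  by rewrite [_ * (kappa b)%:R]mulrC boundaryC gain.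
by rewrite gain // ltn_neqAle ge eq_sym ab.
Qed.

Lemma expect_upper_ge :
  vol R kappa A + total_boundary R A / (2 * #|U|%:R * n%:R ^+ 2)
    <= expect_upper n kappa (fun kappa' => vol R kappa' (upper_shadow kappa' A)).
Proof.
have [u uU] := set0Pn _ U0; rewrite (expect_upperE _ uU).
apply: expect_colors_ge => // [|a b ab]; first exact: bichromatic_neq0.
have N0 : (0 < #|U|)%N by rewrite card_gt0.
have gain (c d : 'I_l) : (c < d)%N ->
  (kappa c)%:R * (kappa d)%:R * vol R kappa A + boundary R A c d / (2 * #|U|%:R)
  <= (kappa c)%:R * (kappa d)%:R
     * vol R (recolor kappa c d) (upper_shadow (recolor kappa c d) A).
  move=> cd; apply: shadow_gain => //.
  - by rewrite neq_ltn; apply/orP; left.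
  - move=> w j wU wj wA; rewrite in_set wU; apply/existsP; exists (update w j c).
    by rewrite wA update_prec // wj.
  - by apply/subsetP => w; rewrite in_set => /andP[].
have [lt|ge] := ltnP a b; first exact: gain.
by rewrite [_ * (kappa b)%:R]mulrC boundaryC gain // ltn_neqAle ge eq_sym ab.
Qed.

End Shadows.

(** * The indicator function of the set *)

Section Indicator.
Variables (R : realType) (l n : nat) (kappa : histogram l) (A : {set coloring l n}).
Local Notation U := (multislice n kappa).
Hypotheses (AU : A \subset U) (U0 : (0 < #|U|)%N).

Definition indicator (u : coloring l n) : R := (u \in A)%:R.

Lemma sum_indicator : \sum_(u in U) indicator u = #|A|%:R.
Proof.
rewrite -sum1_card natr_sum big_mkcond [RHS]big_mkcond; apply: eq_bigr => u _.
rewrite /indicator; have [uA|_] := boolP (u \in A); last by rewrite if_same.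
by rewrite (subsetP AU).
Qed.

(** The swap is an involution, so as many points enter [A] as leave it. *)
Lemma l1_swap_indicator j k :
  l1_swap kappa indicator j k
    = 2 * \sum_(u in A) (act u (tperm j k) \notin A)%:R.
Proof.
have half : \sum_(u in U) (u \in A)%:R * (act u (tperm j k) \notin A)%:R
   = \sum_(u in A) (act u (tperm j k) \notin A)%:R :> R.
  rewrite big_mkcond [RHS]big_mkcond; apply: eq_bigr => u _.
  have [uA|_] := boolP (u \in A); last by rewrite mul0r if_same.
  by rewrite (subsetP AU) // mul1r.
have half' : \sum_(u in U) (act u (tperm j k) \in A)%:R * (u \notin A)%:R
   = \sum_(u in A) (act u (tperm j k) \notin A)%:R :> R.
  rewrite -half -[RHS](sum_act _ _ (tperm j k)); apply: eq_bigr => u _.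
  by rewrite act_tpermK.
rewrite mulr_natl mulr2n -{1}half -half' -big_split; apply: eq_bigr => u _.
rewrite /indicator /shift; case: (u \in A); case: (_ \in A) => /=;
  by rewrite ?(subrr, subr0, sub0r, normrN, normr0, normr1, mul0r, mul1r, addr0, add0r).
Qed.

(** The differences are 0, 1 or -1, so their squares are their absolute values. *)
Lemma energy_indicator :
  energy kappa indicator = \sum_j \sum_k l1_swap kappa indicator j k.
Proof.
do 3!(apply: eq_bigr => ? _); rewrite /indicator /shift.
by case: (_ \in A); case: (_ \in A);
  rewrite ?(subrr, subr0, sub0r, normrN, normr0, normr1, sqrrN, expr1n, expr0n).
Qed.

Lemma sum_l1_swap_indicator :
  \sum_j \sum_k l1_swap kappa indicator j k = 2 * total_boundary R A.
Proof.
rewrite /total_boundary [in RHS]exchange_big mulr_sumr; apply: eq_bigr => j _ /=.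
rewrite [in RHS]exchange_big mulr_sumr; apply: eq_bigr => k _ /=; exact: l1_swap_indicator.
Qed.

Lemma Inf_l1_swap j k :
  l1_swap kappa indicator j k = 2 * #|U|%:R * Inf R kappa A (tperm j k).
Proof.
rewrite l1_swap_indicator /Inf -mulrA; congr (_ * _).
rewrite mulrC divfK ?pnatr_eq0 -?lt0n // -sum1_card natr_sum.
rewrite big_mkcond [RHS]big_mkcond; apply: eq_bigr => u _; rewrite in_set.
have [uA|_] := boolP (u \in A); last by rewrite andbF.
by rewrite (subsetP AU) //=; case: (_ \in A).
Qed.

End Indicator.

(** * Lower bound on the boundary when all influences are small *)

Section Boundary.
Variables (R : realType) (l n : nat) (kappa : histogram l) (A : {set coloring l n}).
Variables (p eps delta : R).
Local Notation U := (multislice n kappa).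
Hypotheses (l2 : (2 <= l)%N) (kappa_gt0 : forall c, (0 < kappa c)%N).
Hypotheses (sum_kappa : (\sum_(i < l) kappa i)%N = n) (AU : A \subset U).
Hypotheses (p0 : 0 < p) (eps0 : 0 < eps) (delta0 : 0 < delta).
Hypotheses (kappa_p : forall i, p * n%:R <= (kappa i)%:R).
Hypothesis volA : eps <= vol R kappa A <= 1 - eps.

Lemma multislice_gt0 : (0 < #|U|)%N.
Proof.
rewrite lt0n; apply/eqP => U0; move: volA; rewrite /vol U0 invr0 mulr0.
by move: eps0; lra.
Qed.

Lemma size_ge2 : (2 <= n)%N.
Proof.
rewrite -sum_kappa; apply: leq_trans l2 _.
by rewrite -[l in leqLHS]card_ord -sum1_card; apply: leq_sum => c _.
Qed.

(** Summing [p * n <= kappa i] gives [l * p <= 1], hence [p <= 1 / 2]. This lets [ln (1 / p)] absorb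
    additive constants. *)
Lemma ln_invp_ge : 1 / 2 <= ln (1 / p).
Proof.
have n0 : 0 < n%:R :> R by rewrite ltr0n; exact: ltnW size_ge2.
have : \sum_(i < l) p * n%:R <= \sum_(i < l) (kappa i)%:R by apply: ler_sum.
rewrite -natr_sum sum_kappa sumr_const card_ord -[_ *+ l]mulr_natl mulrA.
rewrite -[leRHS]mul1r ler_pM2r // => lp.
have p2 : p <= 1 / 2.
  have : 2 * p <= l%:R * p by rewrite ler_wpM2r ?(ltW p0) // ler_nat.
  by lra.
have := ln_le_sub1 p0; rewrite ln_div ?posrE // ln1; lra.
Qed.

Lemma log_sobolev_const_le :
  log_sobolev_const R n kappa <= 9 * l%:R * ln (1 / p) / (n%:R - 1).
Proof.
have n1 : 1 <= n%:R :> R by rewrite ler1n ltnW // size_ge2.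
have n0 : 0 < n%:R :> R by lra.
rewrite /log_sobolev_const ler_wpM2r ?invr_ge0 ?subr_ge0 //.
have -> : 9 * l%:R * ln (1 / p) = \sum_(c < l) 9 * ln (1 / p).
  by rewrite sumr_const card_ord -[RHS]mulr_natl; ring.
(* Each summand is at most [4 + ln (1 / p)], and [4 <= 8 ln (1 / p)]. *)
apply: ler_sum => c _; have := ln_invp_ge.
have : ln n%:R - ln (kappa c).+1%:R <= ln (1 / p).
  have k0 : 0 < (kappa c).+1%:R :> R by rewrite ltr0n.
  have ip0 : 0 < 1 / p by rewrite divr_gt0.
  rewrite -ln_div ?posrE // ler_ln ?posrE ?divr_gt0 //.
  rewrite ler_pdivrMr // mulrAC ler_pdivlMr // mul1r mulrC.
  by apply: le_trans (kappa_p c) _; rewrite ler_nat.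
by lra.
Qed.

(** In [kkl] take [s = n ^ delta]: the bound on influences cancels [s] in the l1 term, while
    [ln s = delta ln n] multiplies the variance. *)
Lemma total_boundary_ge :
  (forall tau, tau \in Trans n -> Inf R kappa A tau < 1 / (n%:R `^ delta)) ->
  eps * delta * ln n%:R * (n%:R * #|U|%:R) <= 88 * (l%:R * ln (1 / p)) * total_boundary R A.
Proof.
move=> small; have N0 : 0 < #|U|%:R :> R by rewrite ltr0n multislice_gt0.
have n2 : 2 <= n%:R :> R by rewrite ler_nat size_ge2.
have n0 : 0 < n%:R :> R by lra.
pose s : R := n%:R `^ delta.
have s0 : 0 < s by rewrite powR_gt0.
have hb j k : l1_swap kappa (indicator R A) j k <= 2 * #|U|%:R * s^-1.
  rewrite (Inf_l1_swap R AU multislice_gt0) ler_wpM2l ?mulr_ge0 //.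
  have [->|jk] := eqVneq j k.
    rewrite /Inf (_ : [set _ in _ | _] = set0) ?cards0 ?mul0r ?invr_ge0 ?(ltW s0) //.
    by apply/setP => u; rewrite !inE tperm1 coloring_act1 andbN andbF.
  rewrite -div1r; apply: ltW; apply: small; apply/imsetP.
  by exists (j, k); rewrite // inE.
have := kkl l2 multislice_gt0 size_ge2 s0 hb.
rewrite energy_indicator sum_l1_swap_indicator // sum_indicator //.
have -> : \sum_(u in U) indicator R A u ^+ 2 = #|A|%:R.
  rewrite -(sum_indicator R AU); apply: eq_bigr => u _.
  by rewrite /indicator; case: (_ \in A); rewrite ?expr1n ?expr0n.
set T := total_boundary R A.
have T0 : 0 <= T by do 3!(apply: sumr_ge0 => ? _).
have -> : ln s = delta * ln n%:R by rewrite /s ln_powR.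
have -> : s * (2 * #|U|%:R / s) / #|U|%:R = 2 by field; rewrite !gt_eqF.
set v := vol R kappa A.
have vA : #|A|%:R = v * #|U|%:R by rewrite /v /vol divfK // gt_eqF.
have -> : #|A|%:R - #|A|%:R ^+ 2 / #|U|%:R = #|U|%:R * (v * (1 - v)) :> R.
  by rewrite vA; field; rewrite gt_eqF.
have ln0 : 0 <= ln n%:R :> R by rewrite ln_ge0; lra.
have L := log_sobolev_const_le; have Lp := ln_invp_ge.
set Lam := l%:R * ln (1 / p).
have Lam1 : 1 <= Lam.
  have : 2 * (1 / 2) <= Lam by apply: ler_pM => //; rewrite ?ler_nat //; lra.
  by lra.
(* The first product gives [v (1 - v) >= eps (1 - eps)], and [eps <= 1 / 2]. *)
have vv : eps / 2 <= v * (1 - v).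
  move/andP: volA => [v1 v2]; rewrite -/v in v1 v2.
  have : 0 <= (v - eps) * (1 - eps - v) by rewrite mulr_ge0 // subr_ge0.
  have : 0 <= eps * (1 / 2 - eps) by rewrite mulr_ge0 ?(ltW eps0) //; lra.
  by lra.
move=> h.
have n1 : 0 < n%:R - 1 :> R by lra.
(* [22 = 9 * 2 + 2 * 2]: the log-Sobolev constant, and the l1 term enlarged by [Lam >= 1]. *)
have h1 : #|U|%:R * (v * (1 - v)) * (delta * ln n%:R + 1) * (n%:R - 1)
    <= 22 * Lam * T.
  have : #|U|%:R * (v * (1 - v)) * (delta * ln n%:R + 1)
     <= (9 * Lam / (n%:R - 1)) * (2 * T) + 2 * (2 * T / (n%:R - 1)).
    rewrite -lerBlDr; apply: le_trans h _.
    by rewrite ler_wpM2r ?mulr_ge0 // /Lam mulrA.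
  rewrite (_ : 9 * Lam / _ * _ + _ = (18 * Lam * T + 4 * T) / (n%:R - 1)); last first.
    by field; lra.
  rewrite ler_pdivlMr // => h1; apply: le_trans h1 _.
  have : 1 * T <= Lam * T by rewrite ler_wpM2r.
  by lra.
have dl : 0 <= delta * ln n%:R by rewrite mulr_ge0 ?(ltW delta0).
(* Uses [n - 1 >= n / 2] and drops the 1 beside [delta ln n]; the final 88 is [22 * 2 * 2]. *)
have h2 : #|U|%:R * (eps / 2) * (delta * ln n%:R) * (n%:R / 2) <= 22 * Lam * T.
  have e1 : 0 <= #|U|%:R * (eps / 2) by rewrite mulr_ge0 // divr_ge0 // ltW.
  apply: le_trans h1; apply: ler_pM; last by lra.
  - exact: mulr_ge0.
  - by rewrite divr_ge0 // ltW.
  - by apply: ler_pM => //; [rewrite ler_wpM2l | lra].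
by lra.
Qed.

Lemma shadow_bound_le :
  (forall tau, tau \in Trans n -> Inf R kappa A tau < 1 / (n%:R `^ delta)) ->
  ln n%:R / n%:R * 176^-1 * (eps * delta / (l%:R * ln (1 / p)))
    <= total_boundary R A / (2 * #|U|%:R * n%:R ^+ 2).
Proof.
move=> /total_boundary_ge; set T := total_boundary R A; set Lam := l%:R * ln (1 / p).
have N0 : 0 < #|U|%:R :> R by rewrite ltr0n multislice_gt0.
have n0 : 0 < n%:R :> R by rewrite ltr0n; exact: ltnW size_ge2.
have Lam0 : 0 < Lam.
  by rewrite mulr_gt0 ?ltr0n ?(ltnW l2) //; have := ln_invp_ge; lra.
move=> h; rewrite ler_pdivlMr ?mulr_gt0 ?exprn_gt0 //.
have c0 : 0 < 88 * Lam by rewrite mulr_gt0.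
(* After clearing denominators both sides agree, since [176 = 2 * 88]. *)
rewrite -(ler_pM2l c0); apply: le_trans h.
rewrite le_eqVlt; apply/orP; left; apply/eqP; field.
by rewrite !gt_eqF.
Qed.

End Boundary.

Theorem theorem4p9 (R : realType) :
  exists c0 : R, 0 < c0 /\
  forall (l n : nat) (kappa : histogram l) (A : {set coloring l n}) (p eps : R),
    (2 <= l)%N ->
    (forall i, (0 < kappa i)%N) ->
    (\sum_(i < l) kappa i)%N = n ->
    A \subset multislice n kappa ->
    0 < p -> 0 < eps ->
    (forall i, p * n%:R <= (kappa i)%:R) ->
    eps <= vol R kappa A <= 1 - eps ->
    forall delta : R, 0 < delta ->
      (expect_lower n kappa (fun kappa' => vol R kappa' (lower_shadow kappa' A))
         >= vol R kappa A
            + ln n%:R / n%:R * c0 * (eps * delta / (l%:R * ln (1 / p)))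
       \/ exists2 tau, tau \in Trans n & Inf R kappa A tau >= 1 / (n%:R `^ delta))
      /\
      (expect_upper n kappa (fun kappa' => vol R kappa' (upper_shadow kappa' A))
         >= vol R kappa A
            + ln n%:R / n%:R * c0 * (eps * delta / (l%:R * ln (1 / p)))
       \/ exists2 tau, tau \in Trans n & Inf R kappa A tau >= 1 / (n%:R `^ delta)).
Proof.
exists 176^-1; split; first by rewrite invr_gt0.
move=> l n kappa A p eps l2 kappa_gt0 sum_kappa AU p0 eps0 kappa_p volA delta delta0.
have U0 : multislice n kappa != set0.
  by rewrite -card_gt0; exact: multislice_gt0 eps0 volA.
(* An influential transposition settles both disjunctions; otherwise one bound on the boundary
   serves both shadows. *)
have [/existsP[tau /andP[tT hI]]|/existsPn none] :=
  boolP [exists tau, (tau \in Trans n) && (1 / (n%:R `^ delta) <= Inf R kappa A tau)].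
  by split; right; exists tau.
have small tau : tau \in Trans n -> Inf R kappa A tau < 1 / (n%:R `^ delta).
  by move=> tT; have := none tau; rewrite tT /= -ltNge.
have bound := shadow_bound_le l2 kappa_gt0 sum_kappa AU p0 eps0 delta0 kappa_p volA small.
split; left.
  by apply: le_trans (expect_lower_ge R l2 kappa_gt0 AU U0); rewrite lerD2l.
by apply: le_trans (expect_upper_ge R l2 kappa_gt0 AU U0); rewrite lerD2l.
Qed.
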